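(* Let $\Omega\subset\mathbb{R}^n$ be a bounded domain, let $\Gamma_D\subset\partial\Omega$ be nonempty, let $\Gamma_N=\partial\Omega\setminus\Gamma_D$ be of class $C^1$ with exterior unit normal $n(x)$ well defined and continuous for $x\in\Gamma_N$, and let $F:\Gamma_D\to\mathbb{R}$ be Lipschitz. Assume that for every $z\in\overline\Omega$ and every $x^*\in\Gamma_N$ with $z\ne x^*$, $$\Big\langle \frac{x^*-z}{|x^*-z|},\, n(x^* )\Big\rangle>0 .$$ Then there exists a unique viscosity solution $u$ of $$-\Delta_\infty u=0\ \text{ in }\Omega,\qquad \frac{\partial u}{\partial n}=0\ \text{ on }\Gamma_N,\qquad u=F\ \text{ on }\Gamma_D.$$
   Context: **Infinity Laplacian.** For a function $\phi$ that is $C^2$ near $x$, $$\Delta_\infty\phi(x)=\Big\langle D^2\phi(x)\frac{\nabla\phi(x)}{|\nabla\phi(x)|},\frac{\nabla\phi(x)}{|\nabla\phi(x)|}\Big\rangle\ \text{ if }\nabla\phi(x)\ne0,\qquad \Delta_\infty\phi(x)=\lim_{y\to x}\frac{2(\phi(y)-\phi(x))}{|y-x|^2}\ \text{ if }\nabla\phi(x)=0,$$ the latter being defined only when the limit exists. $S(x)$ denotes the set of functions $\phi$ of class $C^2$ in a neighborhood of $x$ for which $\Delta_\infty\phi(x)$ is defined, i.e. either $\nabla\phi(x)\neq0$, or $\nabla\phi(x)=0$ and the limit exists. **Viscosity solutions of the mixed problem.** A lower semicontinuous function $u$ on $\overline\Omega$ is a viscosity supersolution if for every $x_0\in\overline\Omega$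 and every $\phi\in S(x_0)$ such that $u-\phi$ has a strict minimum at $x_0$ with $u(x_0)=\phi(x_0)$: $F(x_0)\le\phi(x_0)$ if $x_0\in\Gamma_D$; $\max\{\langle n(x_0),\nabla\phi(x_0)\rangle,-\Delta_\infty\phi(x_0)\}\ge0$ if $x_0\in\Gamma_N$; $-\Delta_\infty\phi(x_0)\ge0$ if $x_0\in\Omega$. An upper semicontinuous function $u$ on $\overline\Omega$ is a viscosity subsolution if for every $x_0\in\overline\Omega$ and every $\phi\in S(x_0)$ such that $u-\phi$ has a strict maximum at $x_0$ with $u(x_0)=\phi(x_0)$: $F(x_0)\ge\phi(x_0)$ if $x_0\in\Gamma_D$; $\min\{\langle n(x_0),\nabla\phi(x_0)\rangle,-\Delta_\infty\phi(x_0)\}\le0$ if $x_0\in\Gamma_N$; $-\Delta_\infty\phi(x_0)\le0$ if $x_0\in\Omega$. A viscosity solution is a function that is both a viscosity supersolution and a viscosity subsolution.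
   Formalization: Solutions must also satisfy u = F pointwise on Γ_D, so uniqueness is among such solutions: with the touching conditions alone, c(1-|x|), 0<c≤1, all solve the problem in the punctured ball with F=0 on the sphere, F(0)=1. Γ_N of class C^1 is read as relatively open in ∂Ω. *)

(* Defs.v *)
(* MathComp-Analysis. *)
From HB Require Import structures.
From mathcomp Require Export all_boot all_order all_algebra.
From mathcomp Require Export all_classical all_reals all_analysis.
Export Order.TTheory GRing.Theory Num.Theory.
Export numFieldNormedType.Exports.

Set Implicit Arguments.
Unset Strict Implicit.
Unset Printing Implicit Defensive.

Local Open Scope classical_set_scope.
Local Open Scope ring_scope.

(* R^n is 'rV[R]_n.  The library norm on 'rV[R]_n is the sup norm; it is used
   only through the topology and boundedness, for which the choice of norm does
   not matter.  All metric quantities use the Euclidean norm below. *)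
Definition dotv (R : realType) (n : nat) (u v : 'rV[R]_n) : R :=
  \sum_(i < n) u 0 i * v 0 i.

Definition enorm (R : realType) (n : nat) (u : 'rV[R]_n) : R :=
  Num.sqrt (dotv u u).

Definition normalize (R : realType) (n : nat) (u : 'rV[R]_n) : 'rV[R]_n :=
  (enorm u)^-1 *: u.

Definition partial (R : realType) (n : nat) (i : 'I_n) (f : 'rV[R]_n -> R) :
  'rV[R]_n -> R := 'D_(delta_mx 0 i) f.

Definition grad (R : realType) (n : nat) (f : 'rV[R]_n -> R) (x : 'rV[R]_n) :
  'rV[R]_n := \row_i partial i f x.

Definition hessian (R : realType) (n : nat) (f : 'rV[R]_n -> R)
  (x : 'rV[R]_n) : 'M[R]_n := \matrix_(i, j) partial i (partial j f) x.

(* f is of class C^1 (resp. C^2) in some neighborhood of x; nothing is asked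
   of f outside that neighborhood. *)
Definition C1_near (R : realType) (n : nat) (f : 'rV[R]_n -> R)
    (x : 'rV[R]_n) : Prop :=
  \forall y \near x, forall i : 'I_n,
    derivable f y (delta_mx 0 i) /\ {for y, continuous (partial i f)}.

Definition C2_near (R : realType) (n : nat) (f : 'rV[R]_n -> R)
    (x : 'rV[R]_n) : Prop :=
  C1_near f x /\ forall i : 'I_n, C1_near (partial i f) x.

Definition inf_laplacian_quot (R : realType) (n : nat) (phi : 'rV[R]_n -> R)
    (x y : 'rV[R]_n) : R :=
  2 * (phi y - phi x) / enorm (y - x) ^+ 2.

(* When grad phi x = 0 this is meaningful only if the limit exists, i.e. for
   test_function phi x. *)
Definition inf_laplacian (R : realType) (n : nat) (phi : 'rV[R]_n -> R)
    (x : 'rV[R]_n) : R :=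
  if grad phi x != 0 then
    let p := normalize (grad phi x) in dotv (p *m hessian phi x) p
  else lim (inf_laplacian_quot phi x y @[y --> x^']).

(* The class S(x). *)
Definition test_function (R : realType) (n : nat) (x : 'rV[R]_n)
    (phi : 'rV[R]_n -> R) : Prop :=
  C2_near phi x /\
  (grad phi x <> 0 \/
   grad phi x = 0 /\ cvg (inf_laplacian_quot phi x y @[y --> x^'])).

Definition boundary (R : realType) (n : nat) (Omega : set 'rV[R]_n) :
  set 'rV[R]_n := closure Omega `\` interior Omega.

Definition is_domain (R : realType) (n : nat) (Omega : set 'rV[R]_n) : Prop :=
  [/\ Omega !=set0, open Omega & connected Omega].

(* After the choice of a coordinate axis k and of its orientation s, Omega is,
   near x, the strict subgraph of gamma, a C^1 function of the other n - 1
   coordinates. *)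
Definition C1_chart (R : realType) (n : nat) (Omega : set 'rV[R]_n)
    (x : 'rV[R]_n) (k : 'I_n) (s : bool) (gamma : 'rV[R]_n.-1 -> R) : Prop :=
  C1_near gamma (col' k x) /\
  \forall y \near x, Omega y <-> (-1) ^+ s * y 0 k < gamma (col' k y).

(* A boundary portion G is of class C^1 if every point x of G has a
   neighborhood in which Omega is on one side of a C^1 graph and in which the
   boundary is contained in G. *)
Definition C1_boundary_portion (R : realType) (n : nat)
    (Omega G : set 'rV[R]_n) : Prop :=
  G `<=` boundary Omega /\
  forall x, G x ->
    (exists (k : 'I_n) (s : bool) (gamma : 'rV[R]_n.-1 -> R),
       C1_chart Omega x k s gamma) /\
    (\forall y \near x, boundary Omega y -> G y).

(* Near x, Omega is the sublevel set {g < 0} of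
   g y = (-1) ^+ s * y 0 k - gamma (col' k y), whose gradient does not vanish;
   hence the exterior unit normal at x is grad g / |grad g|.  It does not
   depend on the chart. *)
Definition exterior_unit_normal (R : realType) (n : nat)
    (Omega : set 'rV[R]_n) (x nu : 'rV[R]_n) : Prop :=
  exists (k : 'I_n) (s : bool) (gamma : 'rV[R]_n.-1 -> R),
    C1_chart Omega x k s gamma /\
    nu = normalize
           (grad (fun y : 'rV[R]_n => (-1) ^+ s * y 0 k - gamma (col' k y)) x).

Definition lipschitz_on_set (R : realType) (n : nat) (A : set 'rV[R]_n)
    (F : 'rV[R]_n -> R) : Prop :=
  exists L : R, forall x y, A x -> A y -> `|F x - F y| <= L * enorm (x - y).

(* Semicontinuity of the restriction of u to A, for the relative topology. *)
Definition lsc_on (R : realType) (n : nat) (A : set 'rV[R]_n)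
    (u : 'rV[R]_n -> R) : Prop :=
  lower_semicontinuous (fun x : subspace A => (u x)%:E).

Definition usc_on (R : realType) (n : nat) (A : set 'rV[R]_n)
    (u : 'rV[R]_n -> R) : Prop :=
  lsc_on A (fun x => - u x).

(* Strict extrema on A are local, as test functions are only constrained near
   the touching point. *)
Definition strict_min (R : realType) (n : nat) (A : set 'rV[R]_n)
    (f : 'rV[R]_n -> R) (x : 'rV[R]_n) : Prop :=
  \forall y \near x, A y -> y <> x -> f x < f y.

Definition strict_max (R : realType) (n : nat) (A : set 'rV[R]_n)
    (f : 'rV[R]_n -> R) (x : 'rV[R]_n) : Prop :=
  \forall y \near x, A y -> y <> x -> f y < f x.

(* In the definitions below, Gamma_N is boundary Omega `\` GammaD, and
   only the values of u on closure Omega, of F on GammaD and of nu on Gamma_N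
   matter. *)
Definition viscosity_supersolution (R : realType) (n : nat)
    (Omega GammaD : set 'rV[R]_n) (nu : 'rV[R]_n -> 'rV[R]_n)
    (F u : 'rV[R]_n -> R) : Prop :=
  lsc_on (closure Omega) u /\
  forall (x0 : 'rV[R]_n) (phi : 'rV[R]_n -> R),
    closure Omega x0 -> test_function x0 phi ->
    strict_min (closure Omega) (fun y => u y - phi y) x0 -> u x0 = phi x0 ->
    [/\ GammaD x0 -> F x0 <= phi x0,
        (boundary Omega `\` GammaD) x0 ->
          0 <= Num.max (dotv (nu x0) (grad phi x0)) (- inf_laplacian phi x0)
      & Omega x0 -> 0 <= - inf_laplacian phi x0].

Definition viscosity_subsolution (R : realType) (n : nat)
    (Omega GammaD : set 'rV[R]_n) (nu : 'rV[R]_n -> 'rV[R]_n)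
    (F u : 'rV[R]_n -> R) : Prop :=
  usc_on (closure Omega) u /\
  forall (x0 : 'rV[R]_n) (phi : 'rV[R]_n -> R),
    closure Omega x0 -> test_function x0 phi ->
    strict_max (closure Omega) (fun y => u y - phi y) x0 -> u x0 = phi x0 ->
    [/\ GammaD x0 -> phi x0 <= F x0,
        (boundary Omega `\` GammaD) x0 ->
          Num.min (dotv (nu x0) (grad phi x0)) (- inf_laplacian phi x0) <= 0
      & Omega x0 -> - inf_laplacian phi x0 <= 0].

Definition viscosity_solution (R : realType) (n : nat)
    (Omega GammaD : set 'rV[R]_n) (nu : 'rV[R]_n -> 'rV[R]_n)
    (F u : 'rV[R]_n -> R) : Prop :=
  viscosity_supersolution Omega GammaD nu F u /\
  viscosity_subsolution Omega GammaD nu F u.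

(* The condition u = F on GammaD is required pointwise, in addition to the
   viscosity inequalities.  These inequalities alone do not imply it, since a
   point of GammaD need not be touched by any test function: for n >= 2, in the
   punctured unit ball with F = 0 on the sphere and F(0) = 1, every
   u(x) = c (1 - |x|) with 0 < c <= 1 is a viscosity_solution. *)
Definition mixed_problem_solution (R : realType) (n : nat)
    (Omega GammaD : set 'rV[R]_n) (nu : 'rV[R]_n -> 'rV[R]_n)
    (F u : 'rV[R]_n -> R) : Prop :=
  viscosity_solution Omega GammaD nu F u /\
  forall x, GammaD x -> u x = F x.

(* Main.v *)
Require Import Defs.
From mathcomp Require Import ring lra.
Set Implicit Arguments.
Unset Strict Implicit.
Unset Printing Implicit Defensive.

(** The Neumann condition disappears once solutions are described by cones.

    At a point x of GammaN the strict convexity hypothesis says that every cone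
    |y - z| with vertex z in closure Omega has a positive normal derivative.
    Hence the cone, slightly bent downwards to [a |y - z| - g |y - z|^2], is a
    strict supersolution both in Omega and on GammaN, and a viscosity
    subsolution u cannot be touched from above by it away from GammaD and from
    z ([subsolution_no_touching]).  Being untouchable by bent cones is
    equivalent, for upper semicontinuous u, to comparison with cones on every
    ball that misses GammaD ([no_touching_cone], [cone_no_touching]), and
    comparison with cones gives back the viscosity inequalities
    ([cone_comparison_subsolution]) by a second order Taylor expansion at x,
    with a cone whose vertex lies slightly behind x in the direction of the
    gradient.  On GammaN that vertex lies in the domain when the normal derivative
    of the test function is positive, which is the only case in
    which something has to be proved.

    All this takes place in the metric space X = closure Omega, with the
    Euclidean distance.  The one geometric fact needed about X is that from z
    one can walk straight towards any p in X as long as GammaD is not met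
    ([domain_visible]): a segment that would leave X does so at a point x of
    GammaN, but there the direction towards p points strictly inwards, again by
    the convexity hypothesis.

    Existence is Perron's method ([perron]).  The supremum u of all
    subsolutions below F satisfies comparison with cones because that property
    is preserved by suprema.  Cones of slope L with vertices on GammaD, L being
    a Lipschitz constant of F, squeeze u near GammaD, and comparison with cones
    makes u locally Lipschitz elsewhere, so u is continuous.  If - u violated
    comparison with cones, then replacing u by the violated cone where it is
    larger ([cone_bump]) would give a larger subsolution.

    Uniqueness ([comparison]) follows the finite difference argument of
    Armstrong and Smart.  For a subsolution u and a supersolution - v, let U
    and V be the maxima of u and v over balls of radius e.  At a maximum point
    of U + V away from GammaD the largest increments of U and V over the ball
    agree, and moving in the direction of that increment stays in the set E of
    maximum points without decreasing the increment.  As U is bounded, the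
    increment vanishes, U and V are constant on the ball, and E is stable under
    steps of length e.  Since X is connected, E would reach GammaD, near which
    U + V is at most 6 L e.  So this is a bound for U + V everywhere. *)

Local Open Scope classical_set_scope.
Local Open Scope ring_scope.

(** * Euclidean geometry of row vectors *)

Section Euclid.
Context {R : realType} {n : nat}.
Implicit Types (u v w x y : 'rV[R]_n) (c : R).

Lemma dotvC u v : dotv u v = dotv v u.
Proof. by apply: eq_bigr => i _; rewrite mulrC. Qed.

Lemma dotvDl u v w : dotv (u + v) w = dotv u w + dotv v w.
Proof.
by rewrite /dotv -big_split; apply: eq_bigr => i _; rewrite mxE mulrDl.
Qed.

Lemma dotvZl c u v : dotv (c *: u) v = c * dotv u v.
Proof.
by rewrite /dotv mulr_sumr; apply: eq_bigr => i _; rewrite mxE mulrA.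
Qed.

Lemma dotvNl u v : dotv (- u) v = - dotv u v.
Proof. by rewrite -scaleN1r dotvZl mulN1r. Qed.

Lemma dotvBl u v w : dotv (u - v) w = dotv u w - dotv v w.
Proof. by rewrite dotvDl dotvNl. Qed.

Lemma dotvDr u v w : dotv w (u + v) = dotv w u + dotv w v.
Proof. by rewrite !(dotvC w) dotvDl. Qed.

Lemma dotvZr c u v : dotv u (c *: v) = c * dotv u v.
Proof. by rewrite !(dotvC u) dotvZl. Qed.

Lemma dotvNr u v : dotv u (- v) = - dotv u v.
Proof. by rewrite !(dotvC u) dotvNl. Qed.

Lemma dotvBr u v w : dotv w (u - v) = dotv w u - dotv w v.
Proof. by rewrite dotvDr dotvNr. Qed.

Definition dotvE := (dotvDl, dotvDr, dotvNl, dotvNr, dotvZl, dotvZr).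

Lemma dotv_ge0 u : 0 <= dotv u u.
Proof. by apply: sumr_ge0 => i _; rewrite -expr2 sqr_ge0. Qed.

Lemma enorm_ge0 u : 0 <= enorm u.
Proof. exact: sqrtr_ge0. Qed.
Hint Resolve enorm_ge0 : core.

Lemma sqr_enorm u : enorm u ^+ 2 = dotv u u.
Proof. by rewrite sqr_sqrtr // dotv_ge0. Qed.

Lemma enorm_eq0 u : enorm u = 0 -> u = 0.
Proof.
move=> u0; have: dotv u u = 0 by rewrite -sqr_enorm u0 expr0n.
move/eqP; rewrite psumr_eq0; last by move=> i _; rewrite -expr2 sqr_ge0.
move/allP => h; apply/rowP => i; rewrite mxE.
by have := h i (mem_index_enum _); rewrite /= -expr2 sqrf_eq0 => /eqP.
Qed.

Lemma enorm_gt0 u : u <> 0 -> 0 < enorm u.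
Proof.
by move=> u0; rewrite lt_def enorm_ge0 andbT; apply/eqP => /enorm_eq0.
Qed.

Lemma enorm_sub_gt0 x y : x <> y -> 0 < enorm (x - y).
Proof. by move=> xy; apply: enorm_gt0 => /eqP; rewrite subr_eq0 => /eqP. Qed.

Lemma enormZ c u : enorm (c *: u) = `|c| * enorm u.
Proof.
by rewrite /enorm dotvZl dotvZr mulrA -expr2 sqrtrM ?sqr_ge0// sqrtr_sqr.
Qed.

Lemma enorm0 : enorm (0 : 'rV[R]_n) = 0.
Proof. by rewrite -(scale0r 0) enormZ normr0 mul0r. Qed.

Lemma enormN u : enorm (- u) = enorm u.
Proof. by rewrite -scaleN1r enormZ normrN normr1 mul1r. Qed.

Lemma edistC x y : enorm (x - y) = enorm (y - x).
Proof. by rewrite -opprB enormN. Qed.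

(** Expand the squared length of [|v|^2 u - <u, v> v]. *)
Lemma dotv_le u v : dotv u v <= enorm u * enorm v.
Proof.
have [->|/eqP v0] := eqVneq v 0.
  by rewrite enorm0 mulr0 -(scale0r 0) dotvZr mul0r.
have vp := enorm_gt0 v0.
have := dotv_ge0 (enorm v ^+ 2 *: u - dotv u v *: v).
rewrite !dotvE (dotvC v u) -!sqr_enorm => h.
have {h}: 0 <= enorm v ^+ 2 * ((enorm u * enorm v) ^+ 2 - dotv u v ^+ 2).
  apply: le_trans h _; rewrite le_eqVlt; apply/orP; left; apply/eqP; ring.
rewrite pmulr_rge0 ?exprn_gt0// subr_ge0 => h.
rewrite (le_trans (ler_norm _))// -ler_sqr ?nnegrE ?mulr_ge0//.
by rewrite real_normK ?num_real.
Qed.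

Lemma enormD u v : enorm (u + v) <= enorm u + enorm v.
Proof.
rewrite -ler_sqr ?nnegrE ?addr_ge0// sqr_enorm !dotvE -!sqr_enorm (dotvC v u).
have := dotv_le u v; nra.
Qed.

Lemma edist_triangle y x w : enorm (x - w) <= enorm (x - y) + enorm (y - w).
Proof. by rewrite -[x - w](subrKA y) enormD. Qed.

Lemma enorm_normalize u : u <> 0 -> enorm (normalize u) = 1.
Proof.
move=> /enorm_gt0 u0; rewrite enormZ ger0_norm ?invr_ge0//.
by rewrite mulVf ?gt_eqF.
Qed.

Lemma enorm_sum u : enorm u <= \sum_i `|u 0 i|.
Proof.
rewrite -ler_sqr ?nnegrE ?sumr_ge0// sqr_enorm expr2 mulr_suml.
apply: ler_sum => i _; rewrite -expr2 -real_normK ?num_real// expr2.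
by rewrite ler_wpM2l// (bigD1 i)//= lerDl sumr_ge0.
Qed.

Lemma coord_enorm u i : `|u 0 i| <= enorm u.
Proof.
rewrite -ler_sqr ?nnegrE// sqr_enorm real_normK ?num_real//.
rewrite /dotv (bigD1 i)//= -expr2 lerDl.
by apply: sumr_ge0 => j _; rewrite -expr2 sqr_ge0.
Qed.

(** The sup norm and the Euclidean norm are equivalent, so neighbourhoods may
    be tested on Euclidean balls. *)
Lemma near_enorm x (P : set 'rV[R]_n) :
  (\forall y \near x, P y) <->
  exists2 d : R, 0 < d & forall y, enorm (y - x) < d -> P y.
Proof.
split.
  move=> /nbhs_ballP[d /= d0 h]; exists d => // y yd; apply: h; split=> // i j.
  rewrite (ord1 i) /ball /= distrC; apply: le_lt_trans yd.
  by have := coord_enorm (y - x) j; rewrite !mxE.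
case=> d d0 h; apply/nbhs_ballP; exists (d / n.+1%:R) => /=.
  by rewrite divr_gt0.
move=> y [_ yd]; apply: h; apply: le_lt_trans (enorm_sum _) _.
apply: (@le_lt_trans _ _ (\sum_(i < n) d / n.+1%:R)).
  apply: ler_sum => i _; rewrite !mxE distrC; apply/ltW.
  exact: yd.
rewrite sumr_const card_ord -[ltLHS]mulr_natl mulrCA -[ltRHS]mulr1 ltr_pM2l//.
by rewrite ltr_pdivrMr// mul1r ltr_nat.
Qed.

Lemma continuous_enorm (f : 'rV[R]_n -> R) x :
  {for x, continuous f} <-> forall e, 0 < e ->
  exists2 d : R, 0 < d & forall y, enorm (y - x) < d -> `|f y - f x| < e.
Proof.
have cvgP := @cvgrPdist_lt R R _ (nbhs x) (nbhs_filter x) f (f x).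
split=> [/cvgP fc e e0|h].
  have /near_enorm[d d0 hd] := fc e e0.
  by exists d => // y /hd; rewrite distrC.
apply/cvgP => e e0; apply/near_enorm; have [d d0 hd] := h e e0.
by exists d => // y /hd; rewrite distrC.
Qed.

End Euclid.
#[global] Hint Extern 0 (is_true (0 <= enorm _)) => exact: enorm_ge0 : core.

(** * Comparison with cones *)

(** If no maximum were attained, the superlevel sets would form a proper
    filter base on K; semicontinuity keeps its cluster points away from every
    level. *)
Lemma usc_argmax (R : realType) (T : topologicalType) (K : set T) (f : T -> R) :
    compact K -> K !=set0 ->
    (forall x (e : R), K x -> 0 < e -> \forall y \near x, K y -> f y < f x + e) ->
  exists2 x, K x & forall y, K y -> f y <= f x.
Proof.
move=> cK [x0 Kx0] uscf; apply: contrapT => nomax.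
have better x : K x -> exists2 y, K y & f x < f y.
  move=> Kx; apply: contrapT => nobetter; apply: nomax; exists x => // y Ky.
  by rewrite leNgt; apply/negP => xy; apply: nobetter; exists y.
pose B y := [set x | K x /\ f y <= f x].
have FB : ProperFilter (filter_from K B).
  apply: filter_from_proper; last by move=> y Ky; exists y; split.
  apply: filter_from_filter; first by exists x0.
  move=> y z Ky Kz; have [yz|/ltW zy] := leP (f y) (f z).
    by exists z => // x [Kx zx]; split; split => //; exact: le_trans zx.
  by exists y => // x [Kx yx]; split; split => //; exact: le_trans yx.
have FK : filter_from K B K by exists x0 => // x [].
have [p [Kp clp]] := cK _ FB FK.
have [q Kq pq] := better p Kp.
have e0 : 0 < f q - f p by rewrite subr_gt0.
have Fq : filter_from K B (B q) by exists q.
have [x [[Kx qx]]] := clp _ _ Fq (uscf p _ Kp e0).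
by rewrite [f p + _]addrC subrK => /(_ Kx); rewrite ltNge qx.
Qed.

(** Steps of the walks below have to be shorter than several positive
    quantities at once. *)
Lemma exists_below4 (R : realType) (a b c d : R) :
    0 < a -> 0 < b -> 0 < c -> 0 < d ->
  exists2 s : R, 0 < s & [/\ s < a, s < b, s < c & s < d].
Proof.
move=> a0 b0 c0 d0; pose t := Num.min a (Num.min b (Num.min c d)).
have t0 : 0 < t by rewrite !lt_min a0 b0 c0.
exists (t / 2); first by rewrite divr_gt0.
have tt : t / 2 < t by rewrite ltr_pdivrMr// ltr_pMr// ltr1n.
by split; apply: lt_le_trans tt _; rewrite /t !ge_min lexx ?orbT.
Qed.

Section Geometry.
Context {R : realType} {n : nat}.
Implicit Types (X D : set 'rV[R]_n) (w : 'rV[R]_n -> R) (x y z p q : 'rV[R]_n)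
  (a b g r s : R).

Definition toward z p (s : R) := z + (s / enorm (p - z)) *: (p - z).

Lemma toward_start z p s : 0 <= s -> z <> p -> enorm (toward z p s - z) = s.
Proof.
move=> s0 /nesym /enorm_sub_gt0 zp.
rewrite /toward addrAC subrr add0r enormZ ger0_norm ?divr_ge0//.
by rewrite divfK ?gt_eqF.
Qed.

Lemma toward_end z p s : z <> p ->
  enorm (p - toward z p s) = `|enorm (p - z) - s|.
Proof.
move=> /nesym /enorm_sub_gt0 zp.
have -> : p - toward z p s = (1 - s / enorm (p - z)) *: (p - z).
  by rewrite /toward opprD addrA scalerBl scale1r.
rewrite enormZ -[X in _ * X]ger0_norm// -normrM mulrBl mul1r.
by rewrite divfK ?gt_eqF.
Qed.

Definition ball_avoids D x r := forall p, D p -> r < enorm (p - x).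

(** What the comparison theory uses of the pair (closure Omega, GammaD). The
    last field replaces convexity of the domain: a straight walk inside a ball
    that misses D does not leave X. *)
Record visible_domain X D : Prop := VisibleDomain {
  vd_compact : compact X;
  vd_connected : connected X;
  vd_sub : D `<=` X;
  vd_nonempty : D !=set0;
  vd_avoids : forall x, X x -> ~ D x -> exists2 r : R, 0 < r & ball_avoids D x r;
  vd_visible : forall z p (s : R), X z -> X p -> z <> p -> 0 <= s ->
    s <= enorm (p - z) -> ball_avoids D z s -> X (toward z p s) }.

Definition usc X w := forall x (e : R), X x -> 0 < e ->
  exists2 d : R, 0 < d & forall y, X y -> enorm (y - x) < d -> w y < w x + e.

(** For g = 0 this is a cone with vertex z; g > 0 bends it downwards, so that
    its second derivative along the rays from z is - 2 g. *)
Definition barrier z a g q := a * enorm (q - z) - g * enorm (q - z) ^+ 2.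

(** Only increments are compared, so the vertical shift that makes G touch w
    at y does not appear. *)
Definition touches_above X w y (G : 'rV[R]_n -> R) :=
  exists2 d : R, 0 < d & forall q, X q -> enorm (q - y) < d ->
    w q - w y <= G q - G y.

(** The bent cones with nonzero gradient at y are the only test functions that
    a subsolution has to be tested with. The notion is local, unlike the
    equivalent [cone_comparison], and this is what allows gluing in
    [cone_bump]. *)
Definition no_touching X D w := forall z y a g,
  X z -> X y -> ~ D y -> y <> z -> 0 < g -> 2 * g * enorm (y - z) < a ->
  ~ touches_above X w y (barrier z a g).

(** With M the maximum of w over the ball, this compares w with the cone of
    vertex x that equals w at x and M on the sphere. Any upper bound M is
    allowed, so that no supremum has to be formed. *)
Definition cone_comparison X D w := forall x r M y,
  X x -> 0 < r -> ball_avoids D x r -> X y -> enorm (y - x) <= r ->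
  (forall q, X q -> enorm (q - x) <= r -> w q <= M) ->
  w y <= w x + (M - w x) * (enorm (y - x) / r).

Lemma ball_avoidsW D x r s : s <= r -> ball_avoids D x r -> ball_avoids D x s.
Proof. by move=> sr xr p /xr; exact: le_lt_trans. Qed.

Lemma ball_avoids_shift D x y r s :
  enorm (y - x) <= s -> ball_avoids D x (r + s) -> ball_avoids D y r.
Proof.
move=> yx xr p /xr; have := edist_triangle y p x; lra.
Qed.

Lemma compact_eball X x r : compact X ->
  compact (X `&` [set y | enorm (y - x) <= r]).
Proof.
move=> cX; apply: compact_closedI => //.
rewrite (_ : mkset _ = ~` [set y | r < enorm (y - x)]); last first.
  by apply/seteqP; split => y /=; rewrite leNgt => /negP.
apply: open_closedC; rewrite openE => y /= ry; apply/near_enorm.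
exists (enorm (y - x) - r); rewrite ?subr_gt0// => q qy /=.
by have := edist_triangle q y x; rewrite (edistC y q); lra.
Qed.

Lemma usc_max X K w : usc X w -> compact K -> K `<=` X -> K !=set0 ->
  exists2 x, K x & forall y, K y -> w y <= w x.
Proof.
move=> uw cK KX K0; apply: usc_argmax => // x e Kx e0; apply/near_enorm.
have [d d0 h] := uw x e (KX _ Kx) e0.
by exists d => // y yx Ky; apply: h => //; exact: KX.
Qed.

Lemma usc_barrier X w z a g : usc X w ->
  usc X (fun q => w q - barrier z a g q).
Proof.
move=> uw x e Xx e0.
have e2 : 0 < e / 2 by rewrite divr_gt0.
have [d d0 h] := uw x _ Xx e2.
pose A := `|a| + `|g| * (2 * enorm (x - z) + 1) + 1.
have A0 : 0 < A.
  by rewrite /A ltr_wpDl// addr_ge0// mulr_ge0// addr_ge0// mulr_ge0.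
exists (Num.min d (Num.min 1 (e / 2 / A))).
  by rewrite !lt_min d0 ltr01 divr_gt0.
move=> y Xy; rewrite !lt_min => /and3P[yd y1 yA].
have := h y Xy yd.
rewrite ltr_pdivlMr// in yA.
suff: `|barrier z a g y - barrier z a g x| <= enorm (y - x) * A.
  by rewrite ler_norml => /andP[]; lra.
have -> : barrier z a g y - barrier z a g x =
    (enorm (y - z) - enorm (x - z)) *
    (a - g * (enorm (y - z) + enorm (x - z))).
  by rewrite /barrier; ring.
have t1 := edist_triangle x y z; have t2 := edist_triangle y x z.
rewrite (edistC x y) in t2.
rewrite normrM; apply: ler_pM => //.
  by rewrite ler_norml; apply/andP; split; lra.
rewrite (le_trans (ler_normB _ _))// /A -addrA lerD2l normrM.
rewrite (ger0_norm (addr_ge0 _ _))//.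
rewrite (@le_trans _ _ (`|g| * (2 * enorm (x - z) + 1)))//; last by lra.
by apply: ler_wpM2l => //; lra.
Qed.

(** If w exceeded the cone somewhere in the ball, it would also exceed a
    slightly steeper and bent cone; the maximum of the difference is then
    attained inside the ball and away from the vertex, where the bent cone
    touches w. *)
Lemma no_touching_cone X D w : visible_domain X D ->
  usc X w -> no_touching X D w -> cone_comparison X D w.
Proof.
move=> dom uw nt x r M y Xx r0 farx Xy yr wM; rewrite leNgt; apply/negP => wy.
pose b := (M - w x) / r.
have wxM : w x <= M by apply: wM; rewrite ?subrr ?enorm0 ?ltW.
have b0 : 0 <= b by rewrite divr_ge0 ?subr_ge0// ltW.
have br : b * r = M - w x by rewrite divfK ?gt_eqF.
have {}wy : w x + b * enorm (y - x) < w y.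
  by rewrite (_ : b * _ = (M - w x) * (enorm (y - x) / r))// /b; ring.
pose eta := w y - w x - b * enorm (y - x).
have eta0 : 0 < eta by rewrite /eta; lra.
pose g := eta / (4 * r ^+ 2).
have r2 : 0 < r ^+ 2 by rewrite exprn_gt0.
have g0 : 0 < g by rewrite divr_gt0// mulr_gt0.
have gr : 4 * (g * r ^+ 2) = eta by rewrite /g; field; rewrite gt_eqF.
pose a := b + 2 * g * r.
have cK := @compact_eball X x r (vd_compact dom).
(* g is so small that the bent cone is still below w at y, and a so large that
   its slope is positive up to the sphere. *)
have [|q [Xq qr] qmax] := usc_max (usc_barrier x a g uw) cK (@subIsetl _ _ _).
  by exists y.
have qy := qmax y (conj Xy yr).
have nDq : ~ D q by move/farx => /=; rewrite ltNge qr.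
have bary : w x < w y - barrier x a g y.
  have yg : enorm (y - x) * (g * r) <= r * (g * r).
    by rewrite ler_wpM2r// mulr_ge0 ?ltW.
  have : 0 <= g * enorm (y - x) ^+ 2 by rewrite mulr_ge0 ?sqr_ge0 ?ltW.
  rewrite /barrier /a; move: gr; rewrite /eta !expr2; lra.
have qx : q <> x.
  move=> E; move: qy bary; rewrite E /barrier subrr enorm0 expr0n/=; lra.
have {}qr : enorm (q - x) < r.
  rewrite lt_neqAle (qr : is_true (_ <= _)) andbT; apply/eqP => E.
  move: qy bary (wM q Xq qr); rewrite /barrier E /a; move: br gr.
  have : 0 < g * (r * r) by rewrite -expr2 mulr_gt0.
  by rewrite /eta !expr2; lra.
apply: (nt x q a g) => //.
  have : g * enorm (q - x) < g * r by rewrite ltr_pM2l.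
  by rewrite /a; lra.
exists (r - enorm (q - x)); first by rewrite subr_gt0.
move=> q' Xq' q'q; suff : w q' - barrier x a g q' <= w q - barrier x a g q by lra.
by apply: qmax; split => //=; have := edist_triangle q q' x; lra.
Qed.

(** Walk from y by s towards the vertex z, to a point c, and compare on the
    ball of radius 2 s around c. Along the ray this is the inequality [2 G(y)
    <= G(c) + G(c')] with c' opposite to c, contrary to the strict concavity
    of the profile of the barrier G. *)
Lemma cone_no_touching X D w : visible_domain X D ->
  cone_comparison X D w -> no_touching X D w.
Proof.
move=> dom cc z y a g Xz Xy nDy yz g0 ag [d d0 touch].
have [r r0 fary] := vd_avoids dom Xy nDy.
have rho0 := enorm_sub_gt0 yz; set rho := enorm (y - z) in ag rho0.
have [m m0 mE] : exists2 m : R, 0 < m & 2 * g * m = a - 2 * g * rho.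
  exists ((a - 2 * g * rho) / (2 * g)); first by apply: divr_gt0; lra.
  by rewrite mulrC divfK// gt_eqF// mulr_gt0.
have [d30 r30] : 0 < d / 3 /\ 0 < r / 3 by split; lra.
have [s s0 [sa sb sc sd]] := exists_below4 rho0 d30 r30 m0.
have {d30 r30} [sb' sc'] : 3 * s < d /\ 3 * s < r by split; lra.
pose c := toward y z s.
have dcy : enorm (c - y) = s by rewrite toward_start// ltW.
have dcz : enorm (c - z) = rho - s.
  by rewrite edistC toward_end// -(edistC y) ger0_norm// subr_ge0 ltW.
have Xc : X c.
  apply: (vd_visible dom) => //; rewrite 1?edistC ?ltW//.
  by apply: ball_avoidsW fary; lra.
(* the bound for w on the ball obtained from the touching barrier, whose profile
   increases up to rho + s *)
pose M := w y - (a * rho - g * rho ^+ 2) +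
  (a * (rho + s) - g * (rho + s) ^+ 2).
have gcs : g * s <= g * m by rewrite ler_pM2l// ltW.
have : w y <= w c + (M - w c) * (enorm (y - c) / (2 * s)).
  apply: cc => //; rewrite ?mulr_gt0//.
  - apply: (@ball_avoids_shift D y c (2 * s) s); first by rewrite dcy.
    by apply: ball_avoidsW fary; lra.
  - by rewrite edistC dcy; lra.
  move=> q Xq qc; have qy : enorm (q - y) < d.
    by have := edist_triangle c q y; rewrite dcy; lra.
  have := touch q Xq qy; rewrite /barrier -/rho.
  have : enorm (q - z) <= rho + s.
    by have := edist_triangle c q z; rewrite dcz; lra.
  set tq := enorm (q - z) => qs.
  have : 0 <= (rho + s - tq) * (a - g * (rho + s + tq)).
    rewrite mulr_ge0 ?subr_ge0//.
    have : g * tq <= g * (rho + s) by rewrite ler_pM2l.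
    lra.
  by rewrite /M; lra.
have -> : enorm (y - c) / (2 * s) = 1 / 2.
  by rewrite edistC dcy; field; rewrite gt_eqF.
have := touch c Xc _; rewrite /barrier -/rho dcz dcy => /(_ _).
have sd' : s < d by lra.
move=> /(_ sd'); rewrite /M.
have : 0 < g * s ^+ 2 by rewrite mulr_gt0// exprn_gt0.
lra.
Qed.

(** A touching barrier would have to decrease by at most b s on a step towards
    its own vertex z, and to increase by at least b s on a step towards p; its
    strictly concave profile increases less than it decreases. *)
Lemma neg_cone_no_touching X D p y k b z a g : visible_domain X D ->
  X p -> X y -> ~ D y -> y <> p -> 0 <= b ->
  X z -> y <> z -> 0 < g -> 2 * g * enorm (y - z) < a ->
  ~ touches_above X (fun q => k - b * enorm (q - p)) y (barrier z a g).
Proof.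
move=> dom Xp Xy nDy yp b0 Xz yz g0 ag [d d0 touch].
have [r r0 fary] := vd_avoids dom Xy nDy.
have rho0 := enorm_sub_gt0 yz; set rho := enorm (y - z) in ag rho0.
have rhop0 := enorm_sub_gt0 yp.
have [m m0 mE] : exists2 m : R, 0 < m & 2 * g * m = a - 2 * g * rho.
  exists ((a - 2 * g * rho) / (2 * g)); first by apply: divr_gt0; lra.
  by rewrite mulrC divfK// gt_eqF// mulr_gt0.
have dr0 : 0 < Num.min d r by rewrite lt_min d0.
have [s s0 [/ltW sa + /ltW sd /ltW se]] := exists_below4 rho0 dr0 m0 rhop0.
rewrite lt_min => /andP[sb sc].
have stepd v : y <> v -> enorm (toward y v s - y) = s.
  by move=> yv; rewrite toward_start// ltW.
have stepX v : X v -> y <> v -> s <= enorm (y - v) -> X (toward y v s).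
  move=> Xv yv sv; apply: (vd_visible dom) => //; [exact: ltW|by rewrite edistC|].
  exact: ball_avoidsW (ltW sc) fary.
have steppos v : y <> v -> s <= enorm (y - v) ->
    enorm (toward y v s - v) = enorm (y - v) - s.
  by move=> yv sv; rewrite edistC toward_end// -(edistC y) ger0_norm// subr_ge0.
have := touch _ (stepX _ Xz yz sa); have := touch _ (stepX _ Xp yp se).
rewrite !stepd// => /(_ sb) tp /(_ sb) tz.
move: tp tz; rewrite /barrier !steppos// -/rho.
set q1 := enorm (toward y p s - z); set q2 := enorm (toward y z s - p).
have q1s : q1 <= rho + s.
  by have := edist_triangle y (toward y p s) z; rewrite stepd// -/rho -/q1; lra.
have q2s : q2 <= enorm (y - p) + s.
  by have := edist_triangle y (toward y z s) p; rewrite stepd// -/q2; lra.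
have : 0 <= (rho + s - q1) * (a - g * (rho + s + q1)).
  rewrite mulr_ge0 ?subr_ge0//.
  have : g * q1 <= g * (rho + s) by rewrite ler_pM2l.
  have : g * s <= g * m by rewrite ler_pM2l.
  lra.
have : b * q2 <= b * (enorm (y - p) + s) by rewrite ler_wpM2l.
have : 0 < g * s ^+ 2 by rewrite mulr_gt0// exprn_gt0.
lra.
Qed.

End Geometry.

(** * Comparison principle *)

Section Comparison.
Context {R : realType} {n : nat}.
Implicit Types (X D : set 'rV[R]_n) (w : 'rV[R]_n -> R) (x y z p q : 'rV[R]_n)
  (a b g r s e L : R).

Lemma usc_cone X p k b : usc X (fun q => k - b * enorm (q - p)).
Proof.
have uk : usc X (fun _ : 'rV[R]_n => k).
  by move=> x e _ e0; exists 1 => // y _ _; rewrite ltrDl.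
have -> : (fun q => k - b * enorm (q - p)) = fun q => k - barrier p b 0 q.
  by apply/funext => q; rewrite /barrier; ring.
exact: usc_barrier.
Qed.

Lemma compact_edist_bound X p : compact X -> X p ->
  exists2 r : R, 0 < r & forall y, X y -> enorm (y - p) < r.
Proof.
move=> cX Xp.
have [|q Xq qmax] := usc_max (@usc_cone X p 0 (-1)) cX (@subset_refl _ _).
  by exists p.
exists (enorm (q - p) + 1); first by have := enorm_ge0 (q - p); lra.
by move=> y /qmax; lra.
Qed.

(** The cone [F p + L |y - p|] stays above F on D, hence, slightly steepened
    and bent, above w on X: the difference cannot have its maximum off D. *)
Lemma upper_barrier X D w (F : 'rV[R]_n -> R) L : visible_domain X D ->
  usc X w -> no_touching X D w -> 0 <= L ->
  (forall p q, D p -> D q -> F q - F p <= L * enorm (q - p)) ->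
  (forall p, D p -> w p <= F p) ->
  forall p y, D p -> X y -> w y <= F p + L * enorm (y - p).
Proof.
move=> dom uw nt L0 LF wF p y Dp Xy; rewrite leNgt; apply/negP => wy.
have Xp := vd_sub dom Dp.
have [r r0 rX] := compact_edist_bound (vd_compact dom) Xp.
pose eta := w y - (F p + L * enorm (y - p)).
have eta0 : 0 < eta by rewrite subr_gt0.
have [g g0 gr] : exists2 g : R, 0 < g & 2 * (g * r ^+ 2) < eta.
  exists (eta / (4 * r ^+ 2)); first by rewrite divr_gt0// mulr_gt0// exprn_gt0.
  rewrite (_ : 2 * _ = eta / 2); first by lra.
  by field; rewrite gt_eqF.
pose a := L + 2 * g * r.
have [|q Xq qmax] := usc_max (usc_barrier p a g uw) (vd_compact dom)
  (@subset_refl _ _); first by exists y.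
have bary : F p < w y - barrier p a g y.
  have yg : enorm (y - p) * (g * r) <= r * (g * r).
    by rewrite ler_wpM2r ?mulr_ge0 ?ltW ?rX.
  have : 0 <= g * enorm (y - p) ^+ 2 by rewrite mulr_ge0 ?sqr_ge0 ?ltW.
  rewrite /barrier /a; move: gr; rewrite /eta !expr2; lra.
have qy : F p < w q - barrier p a g q.
  by apply: lt_le_trans bary _; exact: qmax.
have gq : g * enorm (q - p) <= g * r by rewrite ler_pM2l// ltW// rX.
have nDq : ~ D q.
  move=> Dq; have := LF p q Dp Dq; have := wF q Dq.
  have : enorm (q - p) * (g * enorm (q - p)) <= enorm (q - p) * (g * r).
    by rewrite ler_wpM2l.
  have : 0 <= enorm (q - p) * (g * r).
    by apply: mulr_ge0 => //; apply: mulr_ge0; apply: ltW.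
  by move: qy; rewrite /barrier /a expr2; lra.
have qp : q <> p by move=> E; apply: nDq; rewrite E.
apply: (nt p q a g) => //.
  have : g * enorm (q - p) < g * r by rewrite ltr_pM2l// rX.
  by rewrite /a; lra.
exists 1 => // q' Xq' _.
by have := qmax q' Xq'; lra.
Qed.

Definition ball_max X w e (U : 'rV[R]_n -> R) := forall x, X x ->
  (exists y, [/\ X y, enorm (y - x) <= e & U x = w y]) /\
  (forall y, X y -> enorm (y - x) <= e -> w y <= U x).

Lemma ball_max_exists X w e : compact X -> usc X w -> 0 <= e ->
  exists U, ball_max X w e U.
Proof.
move=> cX uw e0.
suff /choice[U HU] : forall x, exists c, X x ->
  (exists y, [/\ X y, enorm (y - x) <= e & c = w y]) /\
  (forall y, X y -> enorm (y - x) <= e -> w y <= c) by exists U.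
move=> x; have [Xx|nXx] := pselect (X x); last by exists 0.
have [|y [Xy yx] ymax] := usc_max uw (@compact_eball _ _ X x e cX)
  (@subIsetl _ _ _); first by exists x; split => //=; rewrite subrr enorm0.
by exists (w y) => _; split=> [|q Xq qx]; [exists y|exact: ymax].
Qed.

(** The discrete form of infinity subharmonicity. If q maximizes w on the ball
    of radius 2 e, comparison with the cone of vertex x gives [2 U(x) <= w(q)
    + w(x)]; the walk from x towards q provides a z with [w(q) <= U(z)], and
    [w(x) <= U(y)] for every y of the ball. *)
Lemma ball_max_step X D w e U x : visible_domain X D -> usc X w ->
  cone_comparison X D w -> 0 < e -> ball_max X w e U ->
  X x -> ball_avoids D x (2 * e) ->
  exists z, [/\ X z, enorm (z - x) <= e,
    forall y, X y -> enorm (y - x) <= e -> U y <= U z &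
    forall y, X y -> enorm (y - x) <= e -> 2 * U x <= U z + U y].
Proof.
move=> dom uw cc e0 HU Xx farx.
have [|q [Xq /= qx] qmax] := usc_max uw
  (@compact_eball _ _ X x (2 * e) (vd_compact dom)) (@subIsetl _ _ _).
  by exists x; split => //=; rewrite subrr enorm0; lra.
have [z [Xz zx zq]] : exists z, [/\ X z, enorm (z - x) <= e &
    enorm (q - z) <= e].
  have [qxe|qxe] := leP (enorm (q - x)) e.
    by exists x; split => //; rewrite subrr enorm0 ltW.
  have xq : x <> q by move=> E; move: qxe; rewrite E subrr enorm0; lra.
  exists (toward x q e); split.
  - apply: (vd_visible dom) => //; [exact: ltW|exact: ltW|].
    by apply: ball_avoidsW farx; lra.
  - by rewrite toward_start// ltW.
  - by rewrite toward_end// ler_norml; lra.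
have Uzq : w q <= U z by apply: (HU z Xz).2.
have Uq y : X y -> enorm (y - x) <= e -> U y <= w q.
  move=> Xy yx; have [[t [Xt ty ->]] _] := HU y Xy; apply: qmax; split => //=.
  by have := edist_triangle y t x; lra.
exists z; split => // y Xy yx.
  exact: le_trans (Uq y Xy yx) Uzq.
have Uy : w x <= U y by apply: (HU y Xy).2; rewrite 1?edistC.
have [[t [Xt tx ->]] _] := HU x Xx.
have : w t <= w x + (w q - w x) * (enorm (t - x) / (2 * e)).
  apply: cc => //; rewrite ?mulr_gt0//; first by lra.
  by move=> q' Xq' q'x; apply: qmax.
have : (w q - w x) * (enorm (t - x) / (2 * e)) <= (w q - w x) * (1 / 2).
  apply: ler_wpM2l.
    by rewrite subr_ge0; apply: qmax; split=> //=; rewrite subrr enorm0; lra.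
  rewrite ler_pdivrMr ?mulr_gt0//; lra.
lra.
Qed.

Lemma near_prod1 (T U : topologicalType) (t : T * U) (P : set T) :
  (\forall y \near t.1, P y) -> \forall t' \near t, P t'.1.
Proof.
move=> tP; exists (P, setT) => /=; first by split => //; exact: filterT.
by move=> [a b] [].
Qed.

Lemma near_prod2 (T U : topologicalType) (t : T * U) (P : set U) :
  (\forall y \near t.2, P y) -> \forall t' \near t, P t'.2.
Proof.
move=> tP; exists (setT, P) => /=; first by split => //; exact: filterT.
by move=> [a b] [].
Qed.

(** Instead of semicontinuity of U1 and U2, use that of w1 + w2 on the compact
    set of triples made of a centre and one point of its ball for each
    function. *)
Lemma ball_max_sum_argmax X w1 w2 e U1 U2 : compact X -> X !=set0 ->
  usc X w1 -> usc X w2 -> 0 <= e -> ball_max X w1 e U1 -> ball_max X w2 e U2 ->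
  exists2 x, X x & forall y, X y -> U1 y + U2 y <= U1 x + U2 x.
Proof.
move=> cX [x0 Xx0] uw1 uw2 e0 HU1 HU2.
pose K : set ('rV[R]_n * ('rV[R]_n * 'rV[R]_n)) :=
  [set t | [/\ (X `*` (X `*` X)) t, enorm (t.2.1 - t.1) <= e &
    enorm (t.2.2 - t.1) <= e]].
pose T := ('rV[R]_n * ('rV[R]_n * 'rV[R]_n))%type.
have near3 (t : T) (d : R) : 0 < d -> \forall t' \near t,
    [/\ enorm (t'.1 - t.1) < d, enorm (t'.2.1 - t.2.1) < d &
        enorm (t'.2.2 - t.2.2) < d].
  move=> d0.
  have nb (c : 'rV[R]_n) : \forall y \near c, enorm (y - c) < d.
    by apply/near_enorm; exists d.
  have h1 := near_prod1 (nb t.1).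
  have h2 := near_prod2 (near_prod1 (nb t.2.1)).
  have h3 := near_prod2 (near_prod2 (nb t.2.2)).
  by move: h1 h2 h3; apply: filterS3.
have closedK (f : T -> 'rV[R]_n) : (forall (t : T) d, 0 < d ->
    \forall t' \near t, enorm (f t' - f t) < d) ->
    closed [set t : T | enorm (f t - t.1) <= e].
  move=> cf; rewrite (_ : mkset _ = ~` [set t | e < enorm (f t - t.1)]); last first.
    by apply/seteqP; split => t /=; rewrite leNgt => /negP.
  apply: open_closedC; rewrite openE => t /= et.
  have d0 : 0 < (enorm (f t - t.1) - e) / 2 by rewrite divr_gt0// subr_gt0.
  have := cf t _ d0; have := near3 t _ d0; apply: filterS2 => t' [h1 _ _] h2 /=.
  have := edist_triangle (f t') (f t) t.1.
  have := edist_triangle t'.1 (f t') t.1.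
  by rewrite (edistC (f t) (f t')); lra.
have cK : compact K.
  have -> : K = (X `*` (X `*` X)) `&` ([set t : T | enorm (t.2.1 - t.1) <= e] `&`
      [set t : T | enorm (t.2.2 - t.1) <= e]).
    by apply/seteqP; split => t; [case|case => ? []].
  apply: compact_closedI; first by do 2 (apply: compact_setX => //).
  apply: closedI.
    by apply: closedK => t d /(near3 t); apply: filterS => t' [].
  by apply: closedK => t d /(near3 t); apply: filterS => t' [].
have [||[x [y1 y2]] /= [[/= Xx [Xy1 Xy2]] y1x y2x] tmax] :=
    @usc_argmax R T K (fun t => w1 t.2.1 + w2 t.2.2) cK.
- by exists (x0, (x0, x0)); split => //=; rewrite subrr enorm0.
- move=> t c [[_ [X1 X2]] _ _] c0; have c2 : 0 < c / 2 by rewrite divr_gt0.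
  have [d1 d10 h1] := uw1 _ _ X1 c2; have [d2 d20 h2] := uw2 _ _ X2 c2.
  have d0 : 0 < Num.min d1 d2 by rewrite lt_min d10.
  have := near3 t _ d0; apply: filterS => t' [_ t1 t2] [[_ [X1' X2']] _ _].
  move: t1 t2; rewrite !lt_min => /andP[t1 _] /andP[_ t2].
  by have := h1 _ X1' t1; have := h2 _ X2' t2; lra.
exists x => // y Xy.
have [[z1 [Xz1 z1y ->]] _] := HU1 y Xy; have [[z2 [Xz2 z2y ->]] _] := HU2 y Xy.
have := tmax (y, (z1, z2)); rewrite /= => /(_ _)/le_trans; apply; first by split.
by apply: lerD; [apply: (HU1 x Xx).2|apply: (HU2 x Xx).2].
Qed.

Lemma connected_chain X (A : set 'rV[R]_n) e : connected X -> 0 < e ->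
  A `<=` X -> A !=set0 ->
  (forall x y, A x -> X y -> enorm (y - x) <= e -> A y) -> A = X.
Proof.
move=> cX e0 AX A0 step.
have openN (B : set 'rV[R]_n) :
    open [set y | exists2 x, B x & enorm (y - x) < e].
  rewrite openE => y [x Bx yx]; apply/near_enorm.
  exists (e - enorm (y - x)); first by rewrite subr_gt0.
  by move=> q qy; exists x => //; have := edist_triangle y q x; lra.
apply: cX => //.
  exists [set y | exists2 x, A x & enorm (y - x) < e]; first exact: openN.
  apply/seteqP; split => y.
    by move=> Ay; split; [exact: AX|exists y; rewrite // subrr enorm0].
  by case=> Xy [x Ax /ltW]; exact: step.
exists (~` [set y | exists2 x, (X `\` A) x & enorm (y - x) < e]).
  by apply: open_closedC; exact: openN.
apply/seteqP; split => y.
  move=> Ay; split; [exact: AX|case=> x [Xx nAx] yx; apply: nAx].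
  by apply: (step y) => //; rewrite edistC ltW.
case=> Xy nC; apply: contrapT => nAy; apply: nC.
by exists y; rewrite // subrr enorm0.
Qed.

(** The argument of Armstrong and Smart, with [- v] in the role of the
    supersolution. *)
Lemma comparison X D (F : 'rV[R]_n -> R) L u v : visible_domain X D ->
  0 <= L -> (forall p q, D p -> D q -> F q - F p <= L * enorm (q - p)) ->
  usc X u -> no_touching X D u -> (forall p, D p -> u p <= F p) ->
  usc X v -> no_touching X D v -> (forall p, D p -> v p <= - F p) ->
  forall x, X x -> u x + v x <= 0.
Proof.
move=> dom L0 LF uu ntu uF uv ntv vF x0 Xx0; rewrite leNgt; apply/negP => h0.
have ccu := no_touching_cone dom uu ntu; have ccv := no_touching_cone dom uv ntv.
have cX := vd_compact dom.
have bu p y : D p -> X y -> u y <= F p + L * enorm (y - p).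
  exact: upper_barrier.
have bv p y : D p -> X y -> v y <= - F p + L * enorm (y - p).
  apply: (@upper_barrier X D v (fun p => - F p)) => // p' q' Dp' Dq'.
  by have := LF q' p' Dq' Dp'; rewrite edistC; lra.
have [e e0 eh] : exists2 e : R, 0 < e & 6 * (L * e) < u x0 + v x0.
  exists ((u x0 + v x0) / (6 * L + 1)).
    by rewrite divr_gt0//; lra.
  rewrite !mulrA -mulrA mulrC mulrAC ltr_pdivrMr; last by lra.
  by rewrite ltr_pM2l//; lra.
have [U HU] := ball_max_exists cX uu (ltW e0).
have [V HV] := ball_max_exists cX uv (ltW e0).
have [x1 Xx1 x1max] : exists2 x, X x & forall y, X y -> U y + V y <= U x + V x.
  by apply: ball_max_sum_argmax HU HV => //; [exists x0|exact: ltW].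
pose E := [set y | X y /\ U y + V y = U x1 + V x1].
have hE : u x0 + v x0 <= U x1 + V x1.
  apply: le_trans (x1max x0 Xx0).
  by apply: lerD; [apply: (HU x0 Xx0).2|apply: (HV x0 Xx0).2];
    rewrite // subrr enorm0 ltW.
have farE y : E y -> ball_avoids D y (2 * e).
  move=> [Xy yE] p Dp; rewrite ltNge; apply/negP => py.
  have bound w c W : (forall q, X q -> w q <= c + L * enorm (q - p)) ->
      ball_max X w e W -> W y <= c + 3 * (L * e).
    move=> bw /(_ y Xy)[[t [Xt ty ->]] _]; apply: le_trans (bw t Xt) _.
    rewrite lerD2l mulrCA ler_wpM2l//.
    by have := edist_triangle y t p; rewrite (edistC y p); lra.
  have := bound u (F p) U (fun q => bu p q Dp) HU.
  have := bound v (- F p) V (fun q => bv p q Dp) HV.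
  lra.
have stepE y : E y -> exists z, [/\ E z, enorm (z - y) <= e, U y <= U z &
    forall q, X q -> enorm (q - y) <= e ->
      [/\ U q <= U z, V q <= V y + (U z - U y),
       2 * U y <= U z + U q & V y - (U z - U y) <= V q]].
  move=> Ey; have [Xy yE] := Ey.
  have [z [Xz zy zmax zstep]] :=
    ball_max_step dom uu ccu e0 HU Xy (farE y Ey).
  have [t [Xt ty tmax tstep]] :=
    ball_max_step dom uv ccv e0 HV Xy (farE y Ey).
  have yy : enorm (y - y) <= e by rewrite subrr enorm0 ltW.
  have := x1max z Xz; have := x1max t Xt.
  have := zstep t Xt ty; have := tstep z Xz zy; move=> h1 h2 h3 h4.
  (* The increments of U towards z and of V towards t are equal: U + V is maximal
     at y, and V decreases by at most its largest increment. *)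
  have Ez : E z by split => //; lra.
  exists z; split => //; first exact: zmax.
  move=> q Xq qy; have := zmax q Xq qy; have := zstep q Xq qy.
  have := tmax q Xq qy; have := tstep q Xq qy.
  by move=> *; split; lra.
have [y Xy ymax] := usc_max uu cX (@subset_refl _ _) (ex_intro _ x0 Xx0).
have Ubound q : X q -> U q <= u y.
  by move=> Xq; have [[t [Xt _ ->]] _] := HU q Xq; exact: ymax.
(* From a point of E where U increases by s within distance e, one finds points
   of E where U is larger by k s. *)
pose rises s q := exists z, [/\ X z, enorm (z - q) <= e & s <= U z - U q].
have climb s k q : E q -> rises s q ->
    exists q', [/\ E q', rises s q' & U q + k%:R * s <= U q'].
  move=> Eq Hq; elim: k => [|k [q' [Eq' [z [Xz zq' sz]] ih]]].
    by exists q; split => //; rewrite mul0r addr0.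
  have [z' [Ez' z'q' _ hz']] := stepE q' Eq'.
  have [z'' [[Xz'' _] z''z' _ hz'']] := stepE z' Ez'.
  have [a1 _ _ _] := hz' z Xz zq'.
  have q'z' : enorm (q' - z') <= e by rewrite edistC.
  have [_ _ a2 _] := hz'' q' Eq'.1 q'z'.
  exists z'; split => //; first by exists z''; split => //; lra.
  by rewrite -natr1 mulrDl mul1r; lra.
(* U is bounded, so that the increment s is zero. *)
have flat q z : E q -> X z -> enorm (z - q) <= e -> U z <= U q.
  move=> Eq Xz zq; rewrite leNgt; apply/negP => Uqz.
  have s0 : 0 < U z - U q by rewrite subr_gt0.
  have [k hk] : exists k : nat, (u y - U q) / (U z - U q) < k%:R.
    exists (Num.bound `|(u y - U q) / (U z - U q)|).
    exact: le_lt_trans (ler_norm _) (archi_boundP (normr_ge0 _)).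
  have [|q' [[Xq' _] _]] := climb (U z - U q) k q Eq; first by exists z.
  have := Ubound q' Xq'; rewrite ltr_pdivrMr// in hk.
  lra.
have EX : E = X.
  apply: (@connected_chain X E e) => //.
  - exact: vd_connected dom.
  - by move=> q [].
  - by exists x1.
  - move=> q t Eq Xt tq; have [z [[Xz zE] zq Uqz hz]] := stepE q Eq.
    have := flat q z Eq Xz zq; have := flat q t Eq Xt tq.
    have [a1 a2 a3 a4] := hz t Xt tq.
    by have [Xq qE] := Eq; split => //; lra.
have [p Dp] := vd_nonempty dom.
have Ep : E p by rewrite EX; exact: (vd_sub dom).
by have := farE p Ep p Dp; rewrite subrr enorm0; lra.
Qed.

End Comparison.

(** * Perron's method *)

Section Perron.
Context {R : realType} {n : nat}.
Implicit Types (X D : set 'rV[R]_n) (u w : 'rV[R]_n -> R)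
  (x y z p q : 'rV[R]_n) (a b g r s e L m M : R).

Definition continuous_in X w x := forall e, 0 < e ->
  exists2 d : R, 0 < d & forall y, X y -> enorm (y - x) < d -> `|w y - w x| < e.

(** The cones with vertex x bound w above near x, and the cones with vertex y
    bound it below. *)
Lemma cone_comparison_continuous X D w m M x : visible_domain X D ->
  cone_comparison X D w -> (forall y, X y -> m <= w y <= M) ->
  X x -> ~ D x -> continuous_in X w x.
Proof.
move=> dom cc wmM Xx nDx e e0.
have [r2 r20 farx] := vd_avoids dom Xx nDx.
have [r r0 r2E] : exists2 r : R, 0 < r & r2 = r + r.
  by exists (r2 / 2); [rewrite divr_gt0|field].
rewrite {}r2E in farx r20.
have lip y z : X y -> X z -> ball_avoids D y r -> enorm (z - y) <= r ->
    w z - w y <= (M - m) * (enorm (z - y) / r).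
  move=> Xy Xz fary zy.
  have : w z <= w y + (M - w y) * (enorm (z - y) / r).
    by apply: cc => // q Xq _; have /andP[] := wmM q Xq.
  have : (M - w y) * (enorm (z - y) / r) <= (M - m) * (enorm (z - y) / r).
    apply: ler_wpM2r; first by rewrite divr_ge0// ltW.
    by have /andP[+ _] := wmM y Xy; lra.
  lra.
have mM : m <= M by have /andP[+ +] := wmM x Xx; exact: le_trans.
have K0 : 0 < M - m + 1 by lra.
exists (Num.min r (e * r / (M - m + 1))).
  by rewrite lt_min r0 divr_gt0// mulr_gt0.
move=> y Xy; rewrite lt_min => /andP[yr yd].
have ye : (M - m) * (enorm (y - x) / r) < e.
  apply: (@le_lt_trans _ _ ((M - m + 1) * (enorm (y - x) / r))).
    by apply: ler_wpM2r; [rewrite divr_ge0// ltW|lra].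
  by rewrite mulrA ltr_pdivrMr// mulrC -ltr_pdivlMr.
rewrite ltr_norml; apply/andP; split.
  have : w x - w y <= (M - m) * (enorm (x - y) / r).
    apply: lip => //; last by rewrite edistC ltW.
    by apply: ball_avoids_shift (ltW yr) farx.
  by rewrite edistC; lra.
have : w y - w x <= (M - m) * (enorm (y - x) / r).
  by apply: lip => //; [apply: ball_avoidsW farx; lra|exact: ltW].
lra.
Qed.

(** At a point where v exceeds u the barrier touches the cone C, which
    [neg_cone_no_touching] forbids: the vertex x is not such a point because
    [C x = u x], and the condition on the sphere keeps such points inside the
    ball. *)
Lemma cone_bump X D u x r b : visible_domain X D ->
  usc X u -> no_touching X D u ->
  X x -> ball_avoids D x r -> 0 <= b ->
  (forall q, X q -> enorm (q - x) = r -> u x - b * r <= u q) ->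
  let C q := u x - b * enorm (q - x) in
  let v q := if enorm (q - x) <= r then Num.max (u q) (C q) else u q in
  usc X v /\ no_touching X D v.
Proof.
move=> dom uu nt Xx farx b0 sphere C v.
have uv q : u q <= v q by rewrite /v; case: ifP => // _; rewrite le_max lexx.
have vmax q : v q <= Num.max (u q) (C q).
  by rewrite /v; case: ifP => // _; rewrite le_max lexx.
split.
  move=> y e Xy e0; have [d d0 hd] := uu y e Xy e0.
  have [yr|yr] := leP (enorm (y - x)) r.
    have [d' d'0 hd'] := @usc_cone R n X x (u x) b y e Xy e0.
    exists (Num.min d d'); first by rewrite lt_min d0.
    move=> q Xq; rewrite lt_min => /andP[qd qd'].
    apply: le_lt_trans (vmax q) _; rewrite [v y]/v yr gt_max; apply/andP; split.
      by apply: lt_le_trans (hd q Xq qd) _; rewrite lerD2r le_max lexx.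
    by apply: lt_le_trans (hd' q Xq qd') _; rewrite lerD2r le_max lexx orbT.
  exists (Num.min d (enorm (y - x) - r)); first by rewrite lt_min d0 subr_gt0.
  move=> q Xq; rewrite lt_min => /andP[qd qr].
  rewrite /v ifN -?ltNge; first by rewrite ifN -?ltNge//; exact: hd.
  by have := edist_triangle q y x; rewrite (edistC y q); lra.
move=> z y a g Xz Xy nDy yz g0 ag [d d0 touch].
have [vy|vy] := leP (v y) (u y).
  apply: (nt z y a g) => //; exists d => // q Xq qd.
  by have := touch q Xq qd; have := uv q; lra.
have [yr|yr] := leP (enorm (y - x)) r; last first.
  by move: vy; rewrite /v leNgt yr /= ltxx.
move: (vy); rewrite /v yr lt_max ltxx /= => uC.
have vC : v y = C y by rewrite /v yr max_r// ltW.
have yx : y <> x by move=> E; move: uC; rewrite /C E subrr enorm0; lra.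
have {}yr : enorm (y - x) < r.
  rewrite lt_neqAle yr andbT; apply/eqP => E.
  by have := sphere y Xy E; move: uC; rewrite /C E; lra.
apply: (@neg_cone_no_touching R n X D x y (u x) b z a g) => //.
exists (Num.min d (r - enorm (y - x))); first by rewrite lt_min d0 subr_gt0.
move=> q Xq; rewrite lt_min => /andP[qd qr].
have := touch q Xq qd; rewrite vC.
have : C q <= v q.
  rewrite /v ifT; first by rewrite le_max lexx orbT.
  by have := edist_triangle y q x; lra.
rewrite /C; lra.
Qed.

Lemma perron X D (F : 'rV[R]_n -> R) L : visible_domain X D -> 0 <= L ->
  (forall p q, D p -> D q -> F q - F p <= L * enorm (q - p)) ->
  exists u, [/\ usc X u, usc X (fun q => - u q),
    cone_comparison X D u, cone_comparison X D (fun q => - u q) &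
    forall p, D p -> u p = F p].
Proof.
move=> dom L0 LF.
pose sub w := [/\ usc X w, no_touching X D w & forall p, D p -> w p <= F p].
pose A y : set R := [set c | exists2 w, sub w & c = w y].
pose u y := sup (A y).
(* The cones below F show that the family is nonempty, and bound u below. *)
have sub_cone p : D p -> sub (fun q => F p - L * enorm (q - p)).
  move=> Dp; split; first exact: usc_cone.
    move=> z y a g Xz Xy nDy yz g0 ag.
    apply: (@neg_cone_no_touching R n X D) => //; first exact: (vd_sub dom).
    by move=> E; apply: nDy; rewrite E.
  by move=> q Dq; have := LF q p Dq Dp; rewrite edistC; lra.
have sub_le w p y : sub w -> D p -> X y -> w y <= F p + L * enorm (y - p).
  by case=> uw ntw wF Dp Xy; exact: (upper_barrier dom uw ntw L0 LF wF).
have [p0 Dp0] := vd_nonempty dom.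
have A0 y : A y !=set0.
  by exists (F p0 - L * enorm (y - p0)), (fun q => F p0 - L * enorm (q - p0));
    [exact: sub_cone|].
have ub w y : sub w -> X y -> w y <= u y.
  move=> sw Xy; apply: ub_le_sup; last by exists w.
  by exists (F p0 + L * enorm (y - p0)) => _ [w' sw' ->]; exact: sub_le.
have lub y c : (forall w, sub w -> w y <= c) -> u y <= c.
  by move=> h; apply: ge_sup => // _ [w sw ->]; exact: h.
have u_le p y : D p -> X y -> u y <= F p + L * enorm (y - p).
  by move=> Dp Xy; apply: lub => w sw; exact: sub_le.
have u_ge p y : D p -> X y -> F p - L * enorm (y - p) <= u y.
  by move=> Dp Xy; exact: (ub _ _ (sub_cone p Dp) Xy).
have uF p : D p -> u p = F p.
  move=> Dp; have Xp := vd_sub dom Dp.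
  have := u_le p p Dp Xp; have := u_ge p p Dp Xp.
  by rewrite subrr enorm0; lra.
have ccu : cone_comparison X D u.
  move=> x r M y Xx r0 farx Xy yr uM; apply: lub => w sw.
  have [uw ntw wF] := sw.
  have : w y <= w x + (M - w x) * (enorm (y - x) / r).
    apply: (no_touching_cone dom uw ntw) => // q Xq qr.
    exact: le_trans (ub w q sw Xq) (uM q Xq qr).
  have : (u x - w x) * (enorm (y - x) / r) <= (u x - w x) * 1.
    apply: ler_wpM2l; first by rewrite subr_ge0; exact: ub.
    by rewrite ler_pdivrMr// mul1r.
  lra.
have [r r0 rX] := compact_edist_bound (vd_compact dom) (vd_sub dom Dp0).
have u_bound y : X y -> F p0 - L * r <= u y <= F p0 + L * r.
  move=> Xy; have := u_le p0 y Dp0 Xy; have := u_ge p0 y Dp0 Xy.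
  have : L * enorm (y - p0) <= L * r by rewrite ler_wpM2l// ltW// rX.
  by move=> h1 h2 h3; apply/andP; split; lra.
have uc x : X x -> continuous_in X u x.
  move=> Xx; have [Dx|nDx] := pselect (D x); last first.
    exact: cone_comparison_continuous dom ccu u_bound Xx nDx.
  move=> e e0; have L1 : 0 < L + 1 by lra.
  exists (e / (L + 1)); first by rewrite divr_gt0.
  move=> y Xy; rewrite ltr_pdivlMr// => yd.
  have := u_le x y Dx Xy; have := u_ge x y Dx Xy; rewrite (uF x Dx).
  move: (enorm_ge0 (y - x)) yd => h1 h2 h3 h4.
  by rewrite ltr_norml; apply/andP; split; lra.
have uscu : usc X u.
  move=> x e Xx e0; have [d d0 h] := uc x Xx e e0; exists d => // y Xy yx.
  by have := h y Xy yx; rewrite ltr_norml => /andP[]; lra.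
have uscNu : usc X (fun q => - u q).
  move=> x e Xx e0; have [d d0 h] := uc x Xx e e0; exists d => // y Xy yx.
  by have := h y Xy yx; rewrite ltr_norml => /andP[]; lra.
have ntu := cone_no_touching dom ccu.
clear r r0 rX u_bound.
exists u; split => // x r M y Xx r0 farx Xy yr uM.
have [b b0 bE] : exists2 b : R, 0 <= b & b * r = M + u x.
  exists ((M + u x) / r); last by rewrite divfK// gt_eqF.
  apply: divr_ge0; last exact: ltW.
  by have := uM x Xx; rewrite subrr enorm0 => /(_ (ltW r0)); lra.
have [|uv ntv] := cone_bump dom uscu ntu Xx farx b0 (u := u) (x := x) (r := r).
  by move=> q Xq qr; have := uM q Xq; rewrite qr lexx => /(_ isT); lra.
set v := (fun q => if _ then _ else _) in uv ntv.
have : v y <= u y.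
  apply: ub => //; split => // p Dp.
  by rewrite /v ifN ?uF// -ltNge; exact: farx.
rewrite /v yr ge_max => /andP[_].
rewrite (_ : _ * (_ / r) = b * enorm (y - x)); first by lra.
by rewrite -[- u x]opprK opprK; rewrite opprK -bE; field; rewrite gt_eqF.
Qed.

End Perron.

(** * Taylor expansions from continuous partial derivatives *)

Lemma is_derive_epsdelta (R : realType) (V : normedModType R) (f : V -> R)
    (a v : V) (l : R) :
  is_derive a v f l <-> forall e : R, 0 < e -> exists2 d : R, 0 < d &
    forall h : R, h != 0 -> `|h| < d ->
      `|f (h *: v + a) - f a - h * l| <= e * `|h|.
Proof.
pose q (h : R) := h^-1 *: ((f \o shift a) (h *: v) - f a).
have qE (h : R) : h != 0 -> f (h *: v + a) - f a - h * l = h * (q h - l).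
  by move=> h0; rewrite /q /= mulrBr -[h^-1 *: _]/(h^-1 * _) mulrA mulfV// mul1r.
have cvgq := @cvgrPdist_le R R _ (0^') (dnbhs_filter _) q l.
split=> [[df dl] e e0|H].
  have ql : q @ 0^' --> l by rewrite -dl; exact: df.
  have /nbhs_ballP[d /= d0 hd] := cvgq.1 ql e e0.
  exists d => // h h0 hd'; rewrite qE// normrM mulrC ler_wpM2r//.
  by rewrite distrC; apply: hd => //; rewrite /ball/= sub0r normrN.
have ql : q @ 0^' --> l.
  apply/cvgq => e e0; have [d d0 hd] := H e e0.
  apply/nbhs_ballP; exists d => //= h; rewrite /ball/= sub0r normrN => hd' h0.
  have := hd h h0 hd'; rewrite qE// normrM mulrC ler_pM2r ?normr_gt0//.
  by rewrite distrC.
split; first by apply/cvg_ex; exists l.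
exact: (cvg_lim (@Rhausdorff R) ql).
Qed.

(** Every differentiation of a polynomial of degree two along a line is of
    this form. *)
Lemma is_derive_quad (R : realType) (V : normedModType R) (f : V -> R)
    (a v : V) (l c : R) :
  (forall h : R, f (h *: v + a) = f a + h * l + h ^+ 2 * c) ->
  is_derive a v f l.
Proof.
move=> fE; apply/is_derive_epsdelta => e e0.
have c0 : 0 < `|c| + 1 by rewrite ltr_wpDl.
exists (e / (`|c| + 1)); first by rewrite divr_gt0.
move=> h h0; rewrite ltr_pdivlMr// => hd.
rewrite fE (_ : _ - _ = h * (h * c)); last by ring.
rewrite normrM mulrC ler_wpM2r// normrM.
by apply: le_trans (ltW hd); rewrite ler_wpM2l// lerDl.
Qed.

Lemma is_derive_line (R : realType) (V : normedModType R) (f : V -> R)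
    (a v : V) (t l : R) :
  is_derive (a + t *: v) v f l <-> is_derive t 1 (fun s => f (a + s *: v)) l.
Proof.
have E h : a + (h *: 1 + t) *: v = h *: v + (a + t *: v).
  by rewrite [h *: 1]mulr1 scalerDl addrCA.
split=> /is_derive_epsdelta H; apply/is_derive_epsdelta => e e0;
  have [d d0 hd] := H e e0; exists d => // h h0 hd'; have := hd h h0 hd';
  by rewrite E.
Qed.

Section Calculus.
Context {R : realType} {n : nat}.
Implicit Types (x y h v : 'rV[R]_n) (f : 'rV[R]_n -> R).

Lemma dotv_delta v i : dotv v (delta_mx 0 i) = v 0 i.
Proof.
rewrite /dotv (bigD1 i)//= mxE !eqxx mulr1 big1 ?addr0// => j ji.
by rewrite mxE (negPf ji) andbF mulr0.
Qed.

Lemma C1_near_ball f x : C1_near f x -> exists2 d : R, 0 < d &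
  forall y, enorm (y - x) < d -> C1_near f y.
Proof.
move=> /near_enorm[d d0 hd]; exists d => // y yx; apply/near_enorm.
exists (d - enorm (y - x)); first by rewrite subr_gt0.
by move=> q qy; apply: hd; have := edist_triangle y q x; lra.
Qed.

Lemma MVT_line f x v (t : R) : (forall s : R, `|s| <= `|t| ->
    derivable f (x + s *: v) v) ->
  exists2 s : R, `|s| <= `|t| &
    f (x + t *: v) - f x = t * 'D_v f (x + s *: v).
Proof.
move=> df; pose g (s : R) := f (x + s *: v).
pose dg (s : R) : R := 'D_v f (x + s *: v).
have dgP (s : R) : `|s| <= `|t| -> is_derive s 1 g (dg s).
  move=> st; apply: (is_derive_line f x v s (dg s)).1.
  exact: DeriveDef (df s st) erefl.
have cg (a b : R) : (forall s : R, s \in `[a, b] -> `|s| <= `|t|) ->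
    {within `[a, b], continuous g}.
  move=> ab; apply: derivable_within_continuous => s sab.
  by have [] := dgP s (ab s sab).
have fx : f x = g 0 by rewrite /g scale0r addr0.
have [t0|t0] := leP 0 t.
  have ab (s : R) : s \in `[0, t] -> `|s| <= `|t|.
    by rewrite in_itv /= => /andP[s0 st]; rewrite !ger0_norm.
  have [|s sin] := MVT_segment t0 _ (cg _ _ ab) (df := dg).
    by move=> s sin; apply: dgP; apply: ab; exact: subset_itv_oo_cc.
  by rewrite subr0 mulrC -fx => E; exists s => //; exact: ab.
have ab (s : R) : s \in `[t, 0] -> `|s| <= `|t|.
  by rewrite in_itv /= => /andP[ts s0]; rewrite !ler0_norm ?lerN2// ltW.
have [|s sin] := MVT_segment (ltW t0) _ (cg _ _ ab) (df := dg).
  by move=> s sin; apply: dgP; apply: ab; exact: subset_itv_oo_cc.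
rewrite sub0r => E; exists s; first exact: ab.
by rewrite -/(g t) fx -[LHS]opprB E mulrN opprK mulrC.
Qed.

(** Go from x to x + h along the coordinate directions, apply the mean value
    theorem to each step, and use continuity of the partial derivatives at x.
    *)
Lemma C1_near_expand f x : C1_near f x -> forall e : R, 0 < e ->
  exists2 d : R, 0 < d & forall h, enorm h < d ->
    `|f (x + h) - f x - dotv (grad f x) h| <= e * enorm h.
Proof.
move=> C1 e e0; have n0 : 0 < n.+1%:R :> R by rewrite ltr0n.
have en0 : 0 < e / n.+1%:R by rewrite divr_gt0.
have [d d0 hd] : exists2 d : R, 0 < d & forall y, enorm (y - x) < d ->
    forall i, derivable f y (delta_mx 0 i) /\
      `|partial i f y - partial i f x| <= e / n.+1%:R.
  have pc i : \forall y \near x, `|partial i f y - partial i f x| < e / n.+1%:R.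
    apply/near_enorm; apply: (continuous_enorm _ x).1 => //.
    by have := nbhs_singleton C1 => /(_ i)[].
  apply/near_enorm; have /filter_forall := pc.
  by move: C1; apply: filterS2 => y C1y py i; split; [have [] := C1y i|exact: ltW].
exists d => // h hn.
(* h with all coordinates from the k-th on replaced by 0 *)
pose tr (k : nat) : 'rV[R]_n := \row_j (if (j < k)%N then h 0 j else 0).
have trn : tr n = h by apply/rowP => j; rewrite !mxE ltn_ord.
have tr0 : tr 0%N = 0 by apply/rowP => j; rewrite !mxE ltn0.
have step (k : 'I_n) : tr k.+1 = tr k + h 0 k *: delta_mx 0 k.
  apply/rowP => j; rewrite !mxE eqxx /= ltnS leq_eqVlt -val_eqE /=.
  by case: eqVneq => [/val_inj ->|_] /=; rewrite ?ltnn ?add0r ?mulr1// mulr0 addr0.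
have tele m : (m <= n)%N -> f (x + tr m) - f x =
    \sum_(k < m) (f (x + tr k.+1) - f (x + tr k)).
  elim: m => [|m IH] mn; first by rewrite big_ord0 tr0 addr0 subrr.
  by rewrite big_ord_recr /= -IH 1?ltnW// addrC subrKA.
have inb (k : 'I_n) (s : R) : `|s| <= `|h 0 k| ->
    enorm (x + tr k + s *: delta_mx 0 k - x) < d.
  move=> sh; apply: le_lt_trans hn; rewrite -[x + _ + _]addrA addrAC subrr add0r.
  rewrite ler_sqrt ?dotv_ge0//; apply: ler_sum => j _; rewrite !mxE eqxx /=.
  rewrite -!expr2 -[leRHS]real_normK ?num_real// -[leLHS]real_normK ?num_real//.
  rewrite lerXn2r ?nnegrE//.
  have [->|jk] := eqVneq j k; first by rewrite ltnn add0r mulr1.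
  by rewrite mulr0 addr0; case: ifP; rewrite ?normr0.
rewrite -trn (tele n (leqnn n)) trn /dotv -sumrB.
apply: le_trans (ler_norm_sum _ _ _) _.
apply: (@le_trans _ _ (\sum_(k < n) e / n.+1%:R * enorm h)); last first.
  rewrite sumr_const card_ord -[leLHS]mulr_natl mulrA ler_wpM2r//.
  by rewrite mulrCA ler_piMr ?ltW// ltr_pdivrMr// mul1r ltr_nat.
apply: ler_sum => k _; rewrite step addrA.
have [s sk ->] := @MVT_line f (x + tr k) (delta_mx 0 k) (h 0 k)
  (fun s sk => (hd _ (inb k s sk) k).1).
rewrite mxE [_ * h 0 k]mulrC -mulrBr normrM mulrC.
by apply: ler_pM => //; [exact: (hd _ (inb k s sk) k).2|exact: coord_enorm].
Qed.

Lemma C1_near_is_derive f x v : C1_near f x ->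
  is_derive x v f (dotv (grad f x) v).
Proof.
move=> C1; apply/is_derive_epsdelta => e e0.
have v0 : 0 < enorm v + 1 by rewrite ltr_wpDl.
have [d d0 hd] := C1_near_expand C1 (divr_gt0 e0 v0).
exists (d / (enorm v + 1)); first by rewrite divr_gt0.
move=> t t0; rewrite ltr_pdivlMr// => td.
have tv : `|t| * enorm v <= `|t| * (enorm v + 1) by rewrite ler_wpM2l// lerDl.
have := hd (t *: v); rewrite enormZ => /(_ (le_lt_trans tv td)).
rewrite dotvZr [x + _]addrC => /le_trans; apply.
by rewrite mulrAC ler_pdivrMr// mulrAC -mulrA ler_wpM2l ?(ltW e0)// [leRHS]mulrC.
Qed.

(** On the segment from x to x + h the derivative of the remainder only
    involves the first order remainders of the partial derivatives of f. *)
Lemma C2_near_expand f x : C2_near f x -> forall e : R, 0 < e ->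
  exists2 d : R, 0 < d & forall h, enorm h < d ->
    `|f (x + h) - f x - dotv (grad f x) h - dotv (h *m hessian f x) h / 2|
      <= e * enorm h ^+ 2.
Proof.
move=> [C1 C2] e e0; have n0 : 0 < n.+1%:R :> R by rewrite ltr0n.
have en0 : 0 < e / n.+1%:R by rewrite divr_gt0.
have [d1 d10 hd1] := C1_near_ball C1.
have [d d0 hd] : exists2 d : R, 0 < d & forall h, enorm h < d -> forall i,
    `|partial i f (x + h) - partial i f x - dotv (grad (partial i f) x) h|
      <= e / n.+1%:R * enorm h.
  suff /near_enorm[d d0 hd] : \forall y \near x, forall i,
      `|partial i f y - partial i f x - dotv (grad (partial i f) x) (y - x)|
        <= e / n.+1%:R * enorm (y - x).
    by exists d => // h hn i; have := hd (x + h); rewrite addrAC subrr add0r; apply.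
  have Ei i : \forall y \near x,
      `|partial i f y - partial i f x - dotv (grad (partial i f) x) (y - x)|
        <= e / n.+1%:R * enorm (y - x).
    apply/near_enorm; have [d d0 hd] := C1_near_expand (C2 i) en0.
    by exists d => // y yx; have := hd (y - x) yx; rewrite [x + _]addrC subrK.
  by have /filter_forall := Ei.
exists (Num.min d d1); first by rewrite lt_min d0.
move=> h; rewrite lt_min => /andP[hn hn1].
pose Q := dotv (h *m hessian f x) h.
pose G (t : R) : R := f (x + t *: h) - t * dotv (grad f x) h - t ^+ 2 * (Q / 2).
pose dG (t : R) : R := dotv (grad f (x + t *: h)) h - dotv (grad f x) h - t * Q.
have smaller (t : R) : t \in `[0, 1] -> `|t| * enorm h <= enorm h.
  by rewrite in_itv /= => /andP[t0 t1]; rewrite ger0_norm// ler_piMl.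
have dGP (t : R) : t \in `[0, 1] -> is_derive t 1 G (dG t).
  move=> t01.
  have D1 : is_derive t 1 (fun s : R => f (x + s *: h))
      (dotv (grad f (x + t *: h)) h).
    apply: (is_derive_line f x h t _).1; apply: C1_near_is_derive; apply: hd1.
    by rewrite addrAC subrr add0r enormZ; exact: le_lt_trans (smaller t t01) _.
  have D2 : is_derive t 1 (fun s : R => s * dotv (grad f x) h)
      (dotv (grad f x) h).
    apply: (@is_derive_quad R R _ t 1 _ 0) => s /=.
    by rewrite [s *: 1]mulr1; ring.
  have D3 : is_derive t 1 (fun s : R => s ^+ 2 * (Q / 2)) (t * Q).
    apply: (@is_derive_quad R R _ t 1 _ (Q / 2)) => s /=.
    by rewrite [s *: 1]mulr1; field.
  exact: is_deriveB (is_deriveB D1 D2) D3.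
have cG : {within `[0, 1], continuous G}.
  by apply: derivable_within_continuous => s /dGP [].
have dGP' (t : R) : t \in `]0, 1[ -> is_derive t 1 G (dG t).
  by move=> t01; apply: dGP; exact: subset_itv_oo_cc.
have [t t01] := @MVT_segment R G dG 0 1 ler01 dGP' cG.
rewrite subr0 mulr1 => E.
have -> : f (x + h) - f x - dotv (grad f x) h - Q / 2 = dG t.
  by rewrite -E /G scale1r scale0r addr0; ring.
have QE : Q = \sum_i dotv (grad (partial i f) x) h * h 0 i.
  apply: eq_bigr => i _; congr (_ * _); rewrite mxE; apply: eq_bigr => j _.
  by rewrite !mxE mulrC.
have -> : dG t = \sum_i (partial i f (x + t *: h) - partial i f x -
    dotv (grad (partial i f) x) (t *: h)) * h 0 i.
  rewrite /dG QE mulr_sumr /dotv -sumrB -sumrB; apply: eq_bigr => i _.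
  by rewrite !mxE -!/(dotv _ _) dotvZr; ring.
apply: le_trans (ler_norm_sum _ _ _) _.
apply: (@le_trans _ _ (\sum_(k < n) e / n.+1%:R * enorm h ^+ 2)); last first.
  rewrite sumr_const card_ord -[leLHS]mulr_natl mulrA ler_wpM2r ?sqr_ge0//.
  by rewrite mulrCA ler_piMr ?ltW// ltr_pdivrMr// mul1r ltr_nat.
have tn := smaller t t01.
apply: ler_sum => k _; rewrite normrM expr2 mulrA; apply: ler_pM => //.
  have := hd (t *: h); rewrite enormZ => /(_ (le_lt_trans tn hn) k)/le_trans.
  by apply; rewrite ler_wpM2l ?(ltW en0).
exact: coord_enorm.
Qed.

End Calculus.

(** * Quadratic test functions and the sign of the infinity Laplacian *)

Section Quadratic.
Context {R : realType} {n : nat}.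
Implicit Types (x y h v a b e : 'rV[R]_n) (f phi : 'rV[R]_n -> R).

Definition affine x (c : R) b y := c + dotv b (y - x).

Lemma partial_affine x c b i : partial i (affine x c b) = cst (b 0 i).
Proof.
apply/funext => y; apply: derive_val; apply: (@is_derive_quad _ _ _ _ _ _ 0).
move=> h; rewrite /affine /cst -!addrA (dotvDr (h *: _)) dotvZr dotv_delta; ring.
Qed.

Lemma C1_near_affine x c b y : C1_near (affine x c b) y.
Proof.
apply/near_enorm; exists 1 => // q _ i; split; last first.
  by rewrite partial_affine; exact: cst_continuous.
suff [] : is_derive q (delta_mx 0 i) (affine x c b) (b 0 i) by [].
apply: (@is_derive_quad _ _ _ _ _ _ 0) => h.
rewrite /affine -!addrA (dotvDr (h *: _)) dotvZr dotv_delta; ring.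
Qed.

Lemma affine_continuous x c b y : {for y, continuous (affine x c b)}.
Proof.
apply/continuous_enorm => e e0; have b0 : 0 < enorm b + 1 by rewrite ltr_wpDl.
exists (e / (enorm b + 1)); first by rewrite divr_gt0.
move=> q; rewrite ltr_pdivlMr// => qy.
have -> : affine x c b q - affine x c b y = dotv b (q - y).
  by rewrite /affine !dotvBr; ring.
have h : enorm b * enorm (q - y) <= enorm (q - y) * (enorm b + 1).
  by rewrite mulrC ler_wpM2l// lerDl.
apply: le_lt_trans (le_lt_trans h qy); rewrite ler_norml dotv_le andbT.
by rewrite lerNl -dotvNl (le_trans (dotv_le _ _))// enormN.
Qed.

(** Quadratic polynomials are the only test functions that have to be written
    down explicitly: gradient [a] and Hessian [2 k I - 2 m e^T e] at x. *)
Definition quadratic x (c : R) a (k m : R) e y :=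
  c + dotv a (y - x) + k * dotv (y - x) (y - x) - m * dotv e (y - x) ^+ 2.

Lemma is_derive_quadratic x c a k m e i y :
  is_derive y (delta_mx 0 i) (quadratic x c a k m e)
    (affine x (a 0 i) ((2 * k) *: delta_mx 0 i - (2 * m * e 0 i) *: e) y).
Proof.
apply: (@is_derive_quad _ _ _ _ _ _ (k - m * e 0 i ^+ 2)) => h.
rewrite /quadratic /affine -!addrA !dotvE !(dotvC (delta_mx _ _)).
by rewrite !dotv_delta (dotvC y x) mxE !eqxx /=; ring.
Qed.

Lemma partial_quadratic x c a k m e i : partial i (quadratic x c a k m e) =
  affine x (a 0 i) ((2 * k) *: delta_mx 0 i - (2 * m * e 0 i) *: e).
Proof.
by apply/funext => y; apply: derive_val; exact: is_derive_quadratic.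
Qed.

Lemma C2_near_quadratic x c a k m e y : C2_near (quadratic x c a k m e) y.
Proof.
split; last by move=> i; rewrite partial_quadratic; exact: C1_near_affine.
apply/near_enorm; exists 1 => // q _ i; split; last first.
  by rewrite partial_quadratic; exact: affine_continuous.
by have [] := is_derive_quadratic x c a k m e i q.
Qed.

Lemma grad_quadratic x c a k m e : grad (quadratic x c a k m e) x = a.
Proof.
apply/rowP => i; rewrite mxE partial_quadratic /affine subrr.
by rewrite -(scale0r 0) dotvZr mul0r addr0.
Qed.

Lemma hessian_quadratic x c a k m e p :
  dotv (p *m hessian (quadratic x c a k m e) x) p =
  2 * k * dotv p p - 2 * m * dotv e p ^+ 2.
Proof.
have -> : p *m hessian (quadratic x c a k m e) x =
    (2 * k) *: p - (2 * m * dotv e p) *: e.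
  apply/rowP => j; rewrite !mxE.
  under eq_bigr => i _.
    rewrite mxE partial_quadratic partial_affine !mxE mulrBr eqxx /= eq_sym.
    over.
  rewrite big_split /= sumrN; congr (_ - _).
    rewrite (bigD1 j)//= eqxx big1 ?addr0; last first.
      by move=> i /negPf ij; rewrite eq_sym ij !mulr0.
    by rewrite mulr1 mulrC.
  rewrite /dotv mulr_sumr mulr_suml; apply: eq_bigr => i _; ring.
by rewrite dotvBl !dotvZl; ring.
Qed.

Lemma inf_laplacian_quadratic x c (t k m : R) e : 0 < t -> enorm e = 1 ->
  inf_laplacian (quadratic x c (t *: e) k m e) x = 2 * k - 2 * m.
Proof.
move=> t0 e1; have ee : dotv e e = 1 by rewrite -sqr_enorm e1 expr1n.
have e0 : e != 0 by apply/eqP => E; move: e1; rewrite E enorm0; lra.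
rewrite /inf_laplacian grad_quadratic scaler_eq0 gt_eqF//= e0.
rewrite /normalize enormZ e1 mulr1 gtr0_norm// scalerA mulVf ?gt_eqF//.
by rewrite scale1r hessian_quadratic ee expr1n !mulr1.
Qed.

Lemma form_bound (H : 'M[R]_n) : exists2 K : R, 0 < K &
  forall a b, dotv (a *m H) b <= K * (enorm a * enorm b).
Proof.
exists (1 + \sum_j \sum_i `|H i j|).
  by rewrite ltr_wpDr// sumr_ge0// => j _; exact: sumr_ge0.
move=> a b; apply: (@le_trans _ _ ((\sum_j \sum_i `|H i j|) * (enorm a * enorm b))).
  rewrite mulr_suml; apply: ler_sum => j _.
  apply: le_trans (ler_norm _) _; rewrite normrM mulrA ler_pM ?coord_enorm//.
  rewrite mxE mulr_suml; apply: le_trans (ler_norm_sum _ _ _) _.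
  apply: ler_sum => i _; rewrite normrM mulrC.
  by rewrite ler_wpM2l// coord_enorm.
by rewrite ler_wpM2r ?mulr_ge0// lerDr.
Qed.

(** Split q - y into its component t along the ray and an orthogonal part of
    length [sqrt (N^2 - t^2)], where [N = |q - y|]; then [|q - z| <= r + t +
    (N^2 - t^2) / r] for N <= r / 2. The quadratic has the gradient of the
    barrier, and half of the bending is spent on making the inequality strict.
    *)
Lemma barrier_le_quadratic y z c (a g : R) q (e := normalize (y - z))
    (r := enorm (y - z)) : y <> z -> 0 < g -> 0 < a ->
  q <> y -> enorm (q - y) < r / 2 ->
  barrier z a g q - barrier z a g y <
  quadratic y c ((a - 2 * g * r) *: e) (a / r - g / 2) (a / r) e q - c.
Proof.
move=> yz g0 a0 qy qr.
have r0 : 0 < r by exact: enorm_sub_gt0.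
have h0 : 0 < enorm (q - y) by exact: enorm_sub_gt0.
have e1 : enorm e = 1.
  by apply: enorm_normalize => /eqP; rewrite subr_eq0 => /eqP.
have re : y - z = r *: e by rewrite /e /normalize scalerA mulfV ?gt_eqF// scale1r.
clearbody e.
have te := dotv_le e (q - y); have te' := dotv_le (- e) (q - y).
rewrite dotvNl enormN in te'; rewrite !e1 !mul1r in te te'.
rewrite /barrier /quadratic -!sqr_enorm dotvZl -/r.
have s2 : enorm (q - z) ^+ 2 = r ^+ 2 + 2 * r * dotv e (q - y) + enorm (q - y) ^+ 2.
  rewrite sqr_enorm -(subrKA y) re; move: (q - y) => w.
  by rewrite !dotvE -!sqr_enorm e1 expr1n (dotvC w e); ring.
have s0 : 0 <= enorm (q - z) by [].
move: (enorm (q - z)) (enorm (q - y)) (dotv e (q - y)) s2 s0 h0 qr te te'.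
move=> s N t s2 s0 N0 Nr tN tN'.
have m0 : 0 <= N ^+ 2 - t ^+ 2.
  by rewrite subr_sqr mulr_ge0//; lra.
have [k kE] : exists k : R, k * r = N ^+ 2 - t ^+ 2.
  by exists ((N ^+ 2 - t ^+ 2) / r); rewrite divfK// gt_eqF.
have k0 : 0 <= k by rewrite -(pmulr_lge0 _ r0) kE.
have sle : s <= r + t + k.
  rewrite -ler_sqr ?nnegrE//; last by lra.
  have : 0 <= k * (r + 2 * t + k) by apply: mulr_ge0 => //; lra.
  move: s2 kE; rewrite !expr2; lra.
have : a * s <= a * (r + t + k) by rewrite ler_pM2l.
have : 0 < g * N ^+ 2 by rewrite mulr_gt0// exprn_gt0.
have -> : (a / r - g / 2) * N ^+ 2 = a * (k + t ^+ 2 / r) - g / 2 * N ^+ 2.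
  have -> : N ^+ 2 = k * r + t ^+ 2 by rewrite kE subrK.
  by field; rewrite gt_eqF.
have -> : a / r * t ^+ 2 = a * (t ^+ 2 / r) by ring.
rewrite s2; move: (t ^+ 2 / r) => T; lra.
Qed.

End Quadratic.

(** The maximum of the quadratic polynomial in N left after eliminating t is
    of order [s^3]. *)
Lemma cone_error_le (R : realType) (P K s ep t N : R) : 0 < P -> 0 < K -> 0 < s ->
  4 * s * t + N ^+ 2 <= 0 -> 4 * K * s <= P -> 2 * K ^+ 2 * s <= ep * P ->
  P * t + K * s * N + K * N ^+ 2 / 2 <= ep * s ^+ 2.
Proof.
move=> P0 K0 s0 tN KP eP.
rewrite -(@ler_pM2l _ (8 * s * P)) ?mulr_gt0//.
have : P ^+ 2 * (4 * s * t + N ^+ 2) <= 0 by rewrite pmulr_rle0// exprn_gt0.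
have : P * N ^+ 2 * (4 * K * s) <= P * N ^+ 2 * P.
  by rewrite ler_wpM2l// mulr_ge0 ?sqr_ge0// ltW.
have : 0 <= (P * N - 4 * (K * s ^+ 2)) ^+ 2 by exact: sqr_ge0.
have : s ^+ 3 * (2 * K ^+ 2 * s) <= s ^+ 3 * (ep * P).
  by rewrite ler_pM2l// exprn_gt0.
lra.
Qed.

Section TestFunctions.
Context {R : realType} {n : nat}.
Implicit Types (X D : set 'rV[R]_n) (x y h v a b e : 'rV[R]_n)
  (f phi u : 'rV[R]_n -> R).

(** Compare u with the cone of vertex c = x - s e on the ball of radius 2 s,
    where e is the direction of the gradient of phi. Points w of the ball
    where phi is large are within o(s) of x + s e, so that [2 phi(x) <= phi(x
    - s e) + phi(x + s e) + o(s^2)], and the right side is [2 phi(x) + s^2 <e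
    H, e> + o(s^2)]. *)
Lemma cone_comparison_hessian X D u phi x : visible_domain X D ->
  cone_comparison X D u -> X x -> ~ D x -> C2_near phi x -> grad phi x <> 0 ->
  touches_above X u x phi ->
  (exists2 d : R, 0 < d & forall t : R, 0 < t < d ->
     X (x - t *: normalize (grad phi x))) ->
  0 <= dotv (normalize (grad phi x) *m hessian phi x) (normalize (grad phi x)).
Proof.
move=> dom cc Xx nDx C2 g0 [d1 d10 touch] [d2 d20 inX].
have P0 := enorm_gt0 g0; have e1 := enorm_normalize g0.
have gE : grad phi x = enorm (grad phi x) *: normalize (grad phi x).
  by rewrite /normalize scalerA mulfV ?gt_eqF// scale1r.
set P := enorm (grad phi x) in P0 gE.
set e := normalize (grad phi x) in inX e1 gE *.
clearbody e P.
set H := hessian phi x; set Lam := dotv _ _.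
rewrite leNgt; apply/negP => Lam0.
have [K K0 HK] := form_bound H.
have [r r0 farx] := vd_avoids dom Xx nDx.
(* 12 exceeds the total number, 11, of error terms ep s^2 collected below. *)
have [ep ep0 epE] : exists2 ep : R, 0 < ep & 12 * ep = - Lam.
  by exists (- Lam / 12); [lra|field].
have [d3 d30 taylor] := C2_near_expand C2 ep0.
have q1 : 0 < Num.min d1 d3 / 3 by rewrite divr_gt0// lt_min d10.
have q2 : 0 < Num.min d2 (r / 3) by rewrite lt_min d20 divr_gt0.
have q3 : 0 < P / (4 * K) by rewrite divr_gt0// mulr_gt0.
have q4 : 0 < ep * P / (2 * K ^+ 2).
  by rewrite divr_gt0 ?mulr_gt0// exprn_gt0.
have [s s0 [+ + s3 s4]] := exists_below4 q1 q2 q3 q4.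
rewrite ltr_pdivlMr// !lt_min => /andP[s1 s1'] /andP[s2 s2'] {q1 q2 q3 q4}.
have {}s3 : 4 * K * s <= P.
  by rewrite mulrC -ler_pdivlMr ?ltW// mulr_gt0.
have {}s4 : 2 * K ^+ 2 * s <= ep * P.
  by rewrite mulrC -ler_pdivlMr ?ltW// mulr_gt0// exprn_gt0.
pose c := x - s *: e.
have cx : enorm (c - x) = s.
  by rewrite /c addrAC subrr add0r enormN enormZ e1 mulr1 gtr0_norm.
have Xc : X c by apply: inX; rewrite s0.
have uphi q : X q -> enorm (q - x) < d1 -> u q <= u x + (phi q - phi x).
  by move=> Xq qd; have := touch q Xq qd; lra.
have uc : u c <= u x - P * s + s ^+ 2 * (Lam / 2) + ep * s ^+ 2.
  have := uphi c Xc; rewrite cx => /(_ _)/le_trans; apply; first by lra.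
  have := taylor (- (s *: e)); rewrite enormN enormZ e1 mulr1 gtr0_norm//.
  have sd : s < d3 by lra.
  move=> /(_ sd); rewrite -/c ler_norml => /andP[_].
  rewrite gE -scaleNr -scalemxAl !dotvE -!sqr_enorm e1 -/Lam.
  by rewrite expr1n; lra.
pose M := u x + P * s + s ^+ 2 * (Lam / 2) + 10 * (ep * s ^+ 2).
have : u x <= u c + (M - u c) * (enorm (x - c) / (2 * s)).
  apply: cc => //; rewrite ?mulr_gt0//.
  - apply: (@ball_avoids_shift _ _ D x c (2 * s) s); first by rewrite cx.
    by apply: ball_avoidsW farx; lra.
  - by rewrite edistC cx; lra.
  move=> w Xw wc.
  have wx : enorm (w - x) <= 3 * s by have := edist_triangle c w x; rewrite cx; lra.
  apply: le_trans (uphi w Xw _) _; first by lra.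
  (* f measures how far w is from the point opposite to c *)
  pose f := w - x - s *: e.
  have wE : w - x = s *: e + f by rewrite /f [RHS]addrC subrK.
  have fc : w - c = (2 * s) *: e + f.
    by apply/rowP => i; rewrite /f /c !mxE; ring.
  clearbody f.
  have ef : 4 * s * dotv e f + enorm f ^+ 2 <= 0.
    have : enorm (w - c) ^+ 2 <= (2 * s) ^+ 2.
      by rewrite lerXn2r ?nnegrE// mulr_ge0// ltW.
    by rewrite sqr_enorm fc !dotvE (dotvC f e) -!sqr_enorm e1; lra.
  have := taylor (w - x) (_ : is_true (enorm (w - x) < d3)).
  rewrite [x + _]addrC subrK ler_norml => /(_ _)/andP[|_ tay]; first by lra.
  have form : dotv ((w - x) *m H) (w - x) <=
      s ^+ 2 * Lam + 2 * (K * s * enorm f) + K * enorm f ^+ 2.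
    have := HK e f; have := HK f e; have := HK f f.
    rewrite wE e1 mul1r mulr1 mulmxDl -scalemxAl !dotvE -/Lam => h1 h2 h3.
    have : s * dotv (e *m H) f <= s * (K * enorm f) by rewrite ler_pM2l.
    have : s * dotv (f *m H) e <= s * (K * enorm f) by rewrite ler_pM2l.
    rewrite expr2; lra.
  have lin : dotv (grad phi x) (w - x) = P * (s + dotv e f).
    by rewrite gE wE !dotvE -sqr_enorm e1; ring.
  have rem : ep * enorm (w - x) ^+ 2 <= 9 * (ep * s ^+ 2).
    rewrite [leRHS]mulrCA ler_pM2l// (_ : 9 * _ = (3 * s) ^+ 2); last by ring.
    by rewrite lerXn2r ?nnegrE// mulr_ge0// ltW.
  have := cone_error_le P0 K0 s0 ef s3 s4.
  rewrite lin in tay; rewrite /M; lra.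
have -> : enorm (x - c) / (2 * s) = 1 / 2.
  by rewrite edistC cx; field; rewrite gt_eqF.
have : 0 < ep * s ^+ 2 by rewrite mulr_gt0// exprn_gt0.
have : s ^+ 2 * (Lam / 2) = - 6 * (ep * s ^+ 2).
  by rewrite -[Lam]opprK -epE; field.
rewrite /M; lra.
Qed.

(** At the centre c of a ball that contains x, off its sphere, u would be at
    least [u x], as [u x] bounds u on that ball. *)
Lemma cone_comparison_no_strict_max X D u x : visible_domain X D ->
  cone_comparison X D u -> X x -> ~ D x ->
  ~ (exists2 d : R, 0 < d & forall y, X y -> y <> x -> enorm (y - x) < d ->
       u y < u x).
Proof.
move=> dom cc Xx nDx [d d0 umax].
have [r r0 farx] := vd_avoids dom Xx nDx.
have [p Dp] := vd_nonempty dom; have Xp := vd_sub dom Dp.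
have xp : x <> p by move=> E; apply: nDx; rewrite E.
have xp0 : 0 < enorm (p - x) by apply: enorm_sub_gt0 => /esym.
have d30 : 0 < d / 3 by rewrite divr_gt0.
have r30 : 0 < r / 3 by rewrite divr_gt0.
have [s s0 [/ltW s1 s2 s3 _]] := exists_below4 xp0 d30 r30 ltr01.
pose c := toward x p s.
have cx : enorm (c - x) = s by rewrite toward_start// ltW.
have Xc : X c.
  apply: (vd_visible dom) => //; first exact: ltW.
  by apply: ball_avoidsW farx; lra.
have cnx : c <> x by move=> E; move: cx; rewrite E subrr enorm0; lra.
have cd : enorm (c - x) < d by rewrite cx; lra.
have uc := umax c Xc cnx cd.
have : u x <= u c + (u x - u c) * (enorm (x - c) / (2 * s)).
  apply: cc => //; rewrite ?mulr_gt0//.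
  - apply: (@ball_avoids_shift _ _ D x c (2 * s) s); first by rewrite cx.
    by apply: ball_avoidsW farx; lra.
  - by rewrite edistC cx; lra.
  move=> q Xq qc; have [->//|/eqP qx] := eqVneq q x.
  apply/ltW/umax => //.
  by have := edist_triangle c q x; rewrite cx; lra.
have -> : enorm (x - c) / (2 * s) = 1 / 2.
  by rewrite edistC cx; field; rewrite gt_eqF.
lra.
Qed.

(** Where f is not derivable, both limits take the same default value 0. *)
Lemma deriveN_total f x v : 'D_v (fun y => - f y) x = - 'D_v f x.
Proof.
have [df|ndf] := pselect (derivable f x v); first exact: deriveN.
have ndf' : ~ derivable (fun y => - f y) x v.
  move=> /derivableN df; apply: ndf.
  by rewrite (_ : f = - (fun y => - f y)) //; apply/funext => y /=; rewrite opprK.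
by rewrite /derive (dvgP ndf) (dvgP ndf') oppr0.
Qed.

Lemma partialN f i : partial i (fun y => - f y) = fun y => - partial i f y.
Proof. by apply/funext => y; rewrite /partial deriveN_total. Qed.

Lemma gradN f x : grad (fun y => - f y) x = - grad f x.
Proof. by apply/rowP => i; rewrite !mxE partialN. Qed.

Lemma hessianN f x : hessian (fun y => - f y) x = - hessian f x.
Proof. by apply/matrixP => i j; rewrite !mxE !partialN. Qed.

Lemma C1_nearN f x : C1_near f x -> C1_near (fun y => - f y) x.
Proof.
move=> /near_enorm[d d0 h]; apply/near_enorm; exists d => // y yd i.
have [df cf] := h y yd i; split; first exact: derivableN.
rewrite partialN; exact: continuousN.
Qed.

(** The punctured neighbourhoods of a point are nonempty only in positive
    dimension. *)
Lemma dnbhs_proper x p : x <> p -> ProperFilter x^'.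
Proof.
move=> xp; apply: Build_ProperFilter_ex => P.
rewrite /dnbhs /within/= => /near_enorm[d d0 hd].
have d20 : 0 < d / 2 by rewrite divr_gt0.
have xd : enorm (toward x p (d / 2) - x) = d / 2 by rewrite toward_start// ltW.
exists (toward x p (d / 2)); apply: hd; first by rewrite xd; lra.
by apply/eqP => E; move: xd; rewrite E subrr enorm0; lra.
Qed.

Lemma test_functionN x p phi : x <> p -> test_function x phi ->
  test_function x (fun y => - phi y) /\
  inf_laplacian (fun y => - phi y) x = - inf_laplacian phi x.
Proof.
have quotN : inf_laplacian_quot (fun y => - phi y) x =
    (fun y => - inf_laplacian_quot phi x y).
  by apply/funext => y; rewrite /inf_laplacian_quot; ring.
move=> /dnbhs_proper xF [[C1 C2] H].
have C2N : C2_near (fun y => - phi y) x.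
  by split=> [|i]; [exact: (C1_nearN C1)|rewrite partialN; exact: (C1_nearN (C2 i))].
rewrite /test_function /inf_laplacian gradN oppr_eq0.
case: H => [g0|[g0 cv]].
  have -> /= : grad phi x != 0 by apply/eqP.
  split.
    by split => //; left => /eqP; rewrite oppr_eq0 => /eqP.
  have -> : normalize (- grad phi x) = - normalize (grad phi x).
    by rewrite /normalize enormN scalerN.
  by rewrite hessianN mulNmx mulmxN opprK dotvNr.
rewrite g0 eqxx /= oppr0 quotN; split.
  by split => //; right; split => //; exact: (is_cvgN cv).
exact: (limN cv).
Qed.

End TestFunctions.

(** * Viscosity inequalities and the geometry of the domain *)

Section Viscosity.
Context {R : realType} {n : nat}.
Implicit Types (X D Omega : set 'rV[R]_n) (x y z p q v : 'rV[R]_n)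
  (F u phi : 'rV[R]_n -> R) (nu : 'rV[R]_n -> 'rV[R]_n).

Lemma usc_onE X u : usc_on X u <-> usc X u.
Proof.
split=> [uu x e Xx e0|uu x a /=].
  have [|V] := uu x (- (u x + e)); first by rewrite lte_fin ltrN2 ltrDl.
  rewrite /nbhs/= -nbhs_subspace_in// => /near_enorm[d d0 hd] HV.
  exists d => // y Xy yd; have := HV y (hd y yd Xy).
  by rewrite lte_fin ltrN2.
rewrite lte_fin => ax; have [Xx|nXx] := pselect (X x); last first.
  exists [set x]; last by move=> y ->; rewrite lte_fin.
  by rewrite /nbhs/= -nbhs_subspace_out// => y.
have e0 : 0 < - a - u x by lra.
have [d d0 hd] := uu x _ Xx e0.
exists (X `&` [set y | enorm (y - x) < d]).
  rewrite /nbhs/= -nbhs_subspace_in//; by apply/near_enorm; exists d.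
move=> y [Xy yd]; rewrite lte_fin ltrNr.
by have := hd y Xy yd; rewrite addrC subrK.
Qed.

Lemma closure_enorm X x : closure X x <->
  forall d : R, 0 < d -> exists2 y, X y & enorm (y - x) < d.
Proof.
split=> [cx d d0|H B /near_enorm[d d0 hd]].
  have [|y [Xy yx]] := cx [set y | enorm (y - x) < d]; last by exists y.
  by apply/near_enorm; exists d.
by have [y Xy yx] := H d d0; exists y; split => //; exact: hd.
Qed.

Lemma off_Dirichlet Omega D x : closure Omega x -> ~ D x ->
  Omega x \/ (boundary Omega `\` D) x.
Proof.
move=> cx nDx; have [ix|nix] := pselect (interior Omega x).
  by left; exact: interior_subset.
by right.
Qed.

(** The barrier is replaced by a quadratic polynomial with the same gradient
    and negative infinity Laplacian [- g], which contradicts the subsolution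
    inequality in Omega. On GammaN the gradient is a positive multiple of the
    direction from z to y, whose normal component is positive, so the boundary
    alternative fails as well. *)
Lemma subsolution_no_touching Omega D nu F u :
  (forall z x, closure Omega z -> (boundary Omega `\` D) x -> z <> x ->
    0 < dotv (normalize (x - z)) (nu x)) ->
  viscosity_subsolution Omega D nu F u -> no_touching (closure Omega) D u.
Proof.
move=> convex [_ visc] z y a g Xz Xy nDy yz g0 ag [d d0 touch].
set r := enorm (y - z) in ag; pose e := normalize (y - z).
have r0 : 0 < r by exact: enorm_sub_gt0.
have t0 : 0 < a - 2 * g * r by rewrite subr_gt0.
have a0 : 0 < a by apply: lt_trans ag; rewrite mulr_gt0// mulr_gt0.
have e1 : enorm e = 1.
  by apply: enorm_normalize => /eqP; rewrite subr_eq0 => /eqP.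
pose phi := quadratic y (u y) ((a - 2 * g * r) *: e) (a / r - g / 2) (a / r) e.
have phiy : phi y = u y.
  rewrite /phi /quadratic subrr -(scale0r 0) !dotvE.
  by rewrite !mul0r !mulr0 expr0n /= mulr0 subr0 !addr0.
have gphi : grad phi y = (a - 2 * g * r) *: e by exact: grad_quadratic.
have lap : inf_laplacian phi y = - g.
  by rewrite inf_laplacian_quadratic//; move: (a / r) => T; lra.
have test : test_function y phi.
  split; first exact: C2_near_quadratic.
  left; rewrite gphi => /(congr1 (@enorm R n)).
  by rewrite enormZ e1 mulr1 enorm0 gtr0_norm//; lra.
have smax : strict_max (closure Omega) (fun q => u q - phi q) y.
  apply/near_enorm; exists (Num.min d (r / 2)).
    by rewrite lt_min d0 divr_gt0.
  move=> q; rewrite lt_min => /andP[qd qr] Xq qy.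
  have := touch q Xq qd.
  have := @barrier_le_quadratic R n y z (u y) a g q yz g0 a0 qy qr.
  rewrite -/e -/r -/phi phiy; lra.
have [_ hN hI] := visc y phi Xy test smax (esym phiy).
have [/hI|Ny] := off_Dirichlet Xy nDy; first by rewrite lap; lra.
have zy : z <> y by move=> /esym.
have nue := convex z y Xz Ny zy.
have := hN Ny; rewrite lap gphi dotvZr (dotvC _ e) ge_min => /orP[|]; last by lra.
by apply/negP; rewrite -ltNge mulr_gt0.
Qed.

(** The only form in which the boundary charts enter the viscosity theory. At
    a point of Omega every vector is inward. *)
Definition inward Omega D nu := forall x v, closure Omega x -> ~ D x ->
  ((boundary Omega `\` D) x -> dotv v (nu x) < 0) ->
  exists2 d : R, 0 < d & forall t : R, 0 < t < d -> Omega (x + t *: v).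

(** If the gradient of phi vanishes at x, the boundary inequality on GammaN
    holds trivially, and in Omega a negative infinity Laplacian would make x a
    strict local maximum of u. *)
Lemma cone_comparison_subsolution Omega D nu F u :
  visible_domain (closure Omega) D -> inward Omega D nu ->
  open Omega -> D `<=` boundary Omega ->
  usc (closure Omega) u -> cone_comparison (closure Omega) D u ->
  (forall p, D p -> u p <= F p) -> viscosity_subsolution Omega D nu F u.
Proof.
move=> dom inw oO Dbd uu cc uF; split; first exact/usc_onE.
move=> x phi Xx [C2 tphi] /near_enorm[d d0 smax] uphi.
have touch : touches_above (closure Omega) u x phi.
  exists d => // q Xq qd; have [->|/eqP qx] := eqVneq q x; first by rewrite !subrr.
  by have := smax q qd Xq qx; lra.
have key : ~ D x ->
    ((boundary Omega `\` D) x -> 0 < dotv (nu x) (grad phi x)) ->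
    0 <= inf_laplacian phi x.
  move=> nDx Nx; case: tphi => [g0|[g0 cv]].
    rewrite /inf_laplacian ifT; last exact/eqP.
    apply: (cone_comparison_hessian dom cc Xx nDx C2 g0 touch).
    have nin : (boundary Omega `\` D) x ->
        dotv (- normalize (grad phi x)) (nu x) < 0.
      move=> /Nx; rewrite dotvNl dotvZl dotvC oppr_lt0 => Nx'.
      by rewrite mulr_gt0// invr_gt0 enorm_gt0.
    have [d1 d10 hd1] := inw x _ Xx nDx nin.
    exists d1 => // t td; rewrite -scalerN; apply: subset_closure.
    exact: hd1.
  rewrite /inf_laplacian g0 eqxx /= leNgt; apply/negP.
  set l := lim _ => l0.
  have := (@cvgrPdist_lt R R _ (x^') (dnbhs_filter _) _ l).1 cv (- l).
  rewrite oppr_gt0 => /(_ l0); rewrite /dnbhs /within /= => /near_enorm[d1 d10 neg].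
  apply: (cone_comparison_no_strict_max dom cc Xx nDx).
  exists (Num.min d d1); first by rewrite lt_min d0.
  move=> q Xq qx; rewrite lt_min => /andP[qd qd1].
  have := smax q qd Xq qx; have := neg q qd1 (introN eqP qx).
  rewrite ltr_norml => /andP[lq _].
  have [lt|ge] := ltP (phi q) (phi x); first by lra.
  have : 0 <= inf_laplacian_quot phi x q.
    by rewrite /inf_laplacian_quot divr_ge0 ?exprn_ge0// mulr_ge0// subr_ge0.
  lra.
split.
- by move=> Dx; rewrite -uphi; exact: uF.
- move=> Nx; rewrite ge_min; have [//|nug] := leP (dotv (nu x) (grad phi x)) 0.
  by rewrite oppr_le0 key//; case: Nx.
- move=> Ox; have iO : interior Omega x by apply: open_nbhs_nbhs.
  rewrite oppr_le0; apply: key => [/Dbd[]//|[[_ []]//]].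
Qed.

Lemma supersolutionN Omega D nu F u : (forall x, exists p, x <> p) ->
  viscosity_supersolution Omega D nu F u <->
  viscosity_subsolution Omega D nu (fun x => - F x) (fun x => - u x).
Proof.
move=> other; rewrite /viscosity_supersolution /viscosity_subsolution /usc_on.
have -> : (fun x => - - u x) = u by apply/funext => x; rewrite opprK.
split=> -[lsc visc]; split => // x phi Xx test near_x uphi.
  have [p xp] := other x; have [testN lapN] := test_functionN xp test.
  have [||hD hN hI] := visc x (fun y => - phi y) Xx testN.
  - move: near_x; rewrite /strict_max /strict_min => /near_enorm[d d0 hd].
    apply/near_enorm; exists d => // y yd Xy yx.
    by have := hd y yd Xy yx; lra.
  - by rewrite -uphi opprK.
  rewrite lapN opprK in hN hI; rewrite gradN dotvNr in hN.
  split=> [/hD|/hN|/hI]; [by lra| |by lra].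
  by rewrite le_max ge_min => /orP[h|h]; apply/orP; [left|right]; lra.
have [p xp] := other x; have [testN lapN] := test_functionN xp test.
have [||hD hN hI] := visc x (fun y => - phi y) Xx testN.
- move: near_x; rewrite /strict_max /strict_min => /near_enorm[d d0 hd].
  apply/near_enorm; exists d => // y yd Xy yx.
  by have := hd y yd Xy yx; lra.
- by rewrite uphi.
rewrite lapN opprK in hN hI; rewrite gradN dotvNr in hN.
split=> [/hD|/hN|/hI]; [by lra| |by lra].
by rewrite le_max ge_min => /orP[h|h]; apply/orP; [left|right]; lra.
Qed.

End Viscosity.

Section Domain.
Context {R : realType} {n : nat}.
Implicit Types (Omega D : set 'rV[R]_n) (x y z p q v : 'rV[R]_n).

(** The chain rule for the inner map [col' k], which is linear: the
    directional derivatives of g at x are therefore linear in the direction.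
    *)
Lemma is_derive_chart (k : 'I_n) (s : bool) (gamma : 'rV[R]_n.-1 -> R) x v
    (g := fun y : 'rV[R]_n => (-1) ^+ s * y 0 k - gamma (col' k y)) :
  C1_near gamma (col' k x) -> is_derive x v g (dotv (grad g x) v).
Proof.
move=> C1; pose c := grad gamma (col' k x).
pose l v := (-1) ^+ s * v 0 k - dotv c (col' k v).
have dg w : is_derive x w g (l w).
  apply/is_derive_epsdelta => e e0.
  have [d d0 hd] :=
    (is_derive_epsdelta _ _ _ _).1 (C1_near_is_derive (col' k w) C1) e e0.
  exists d => // h h0 hd'; have := hd h h0 hd'; rewrite -normrN.
  congr (`|_| <= _); rewrite /g /l !mxE.
  have -> : col' k (h *: w + x) = h *: col' k w + col' k x.
    by apply/rowP => j; rewrite !mxE.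
  rewrite -/c; ring.
have gE : grad g x = \row_i l (delta_mx 0 i).
  by apply/rowP => i; rewrite !mxE; apply: derive_val; exact: dg.
suff -> : dotv (grad g x) v = l v by [].
have lD : {morph l : u w / u + w}.
  move=> u w; rewrite /l mxE (_ : col' k (u + w) = col' k u + col' k w).
    by rewrite dotvDr; ring.
  by apply/rowP => j; rewrite !mxE.
have lZ a w : l (a *: w) = a * l w.
  rewrite /l mxE (_ : col' k (a *: w) = a *: col' k w).
    by rewrite dotvZr; ring.
  by apply/rowP => j; rewrite !mxE.
have l0 : l 0 = 0 by rewrite -(scale0r 0) lZ mul0r.
rewrite [in RHS](row_sum_delta v) (big_morph l lD l0) gE.
by apply: eq_bigr => i _; rewrite mxE lZ mulrC.
Qed.

Lemma enorm_col' k v : enorm (col' k v) <= enorm v.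
Proof.
rewrite ler_sqrt ?dotv_ge0// /dotv (bigD1_ord k)//=.
rewrite -[leLHS]add0r lerD// -?expr2 ?sqr_ge0// ler_sum// => j _.
by rewrite !mxE.
Qed.

Lemma C1_near_continuous m (f : 'rV[R]_m -> R) (x : 'rV[R]_m) (e : R) :
  C1_near f x -> 0 < e -> exists2 d : R, 0 < d &
    forall h, enorm h < d -> `|f (x + h) - f x| < e.
Proof.
move=> C1 e0; have [d d0 hd] := C1_near_expand C1 ltr01.
have K0 : 0 < enorm (grad f x) + 1 by rewrite ltr_wpDl.
exists (Num.min d (e / (enorm (grad f x) + 1))).
  by rewrite lt_min d0 divr_gt0.
move=> h; rewrite lt_min ltr_pdivlMr// => /andP[/hd hd1 he].
apply: le_lt_trans he; rewrite mulrC mulrDl.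
rewrite -[_ - _](subrK (dotv (grad f x) h)) (le_trans (ler_normD _ _))// addrC.
rewrite lerD// ler_norml dotv_le andbT lerNl -dotvNl.
by rewrite (le_trans (dotv_le _ _))// enormN.
Qed.

Lemma normal_inward Omega x nu v : open Omega -> boundary Omega x ->
  exterior_unit_normal Omega x nu -> dotv v nu < 0 ->
  exists2 d : R, 0 < d & forall t : R, 0 < t < d -> Omega (x + t *: v).
Proof.
move=> oO [cx nix] [k [s [gamma [[C1 /near_enorm[d d0 hd]] ->]]]].
set g := fun y : 'rV[R]_n => _ => vn.
have dg := is_derive_chart s v C1; rewrite -/g in dg.
have gO y : enorm (y - x) < d -> Omega y <-> g y < 0.
  by move=> yd; rewrite hd// /g subr_lt0.
(* x is a limit of points of Omega, and g is continuous at x *)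
have gx : g x <= 0.
  rewrite leNgt; apply/negP => gx0.
  have e0 : 0 < g x / 2 by rewrite divr_gt0.
  have [d1 d10 hd1] := C1_near_continuous C1 e0.
  pose r := Num.min d (Num.min d1 (g x / 2)).
  have r0 : 0 < r by rewrite !lt_min d0 d10.
  have [y Oy] := (closure_enorm _ _).1 cx r r0.
  rewrite !lt_min => /and3P[yd yd1 yg].
  have := (gO y yd).1 Oy.
  have := hd1 (col' k (y - x)) (le_lt_trans (enorm_col' k _) yd1).
  have -> : col' k x + col' k (y - x) = col' k y.
    by apply/rowP => j; rewrite !mxE addrC subrK.
  have : `|(-1) ^+ s * y 0 k - (-1) ^+ s * x 0 k| < g x / 2.
    rewrite -mulrBr normrM normrX normrN1 expr1n mul1r.
    by apply: le_lt_trans yg; have := coord_enorm (y - x) k; rewrite !mxE.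
  rewrite /g !ltr_norml => /andP[h1 h2] /andP[h3 h4]; lra.
have l0 : dotv (grad g x) v < 0.
  move: vn; rewrite dotvC dotvZl; apply: contraTT; rewrite -!leNgt => h.
  by rewrite mulr_ge0// invr_ge0.
have e0 : 0 < - dotv (grad g x) v / 2 by rewrite divr_gt0// oppr_gt0.
have [d1 d10 hd1] := (is_derive_epsdelta _ _ _ _).1 dg _ e0.
have v0 : 0 < enorm v + 1 by rewrite ltr_wpDl.
exists (Num.min d1 (d / (enorm v + 1))); first by rewrite lt_min d10 divr_gt0.
move=> t /andP[t0]; rewrite lt_min ltr_pdivlMr// => /andP[td1 td].
have t1 : `|t| < d1 by rewrite gtr0_norm.
have := hd1 t (lt0r_neq0 t0) t1; rewrite [t *: v + x]addrC (gtr0_norm t0) => gt.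
apply/gO.
  rewrite addrAC subrr add0r enormZ gtr0_norm//.
  have : t * enorm v <= t * (enorm v + 1) by rewrite ler_wpM2l ?(ltW t0)// lerDl.
  lra.
move: gt; rewrite ler_norml => /andP[_].
have : 0 < t * - dotv (grad g x) v by rewrite mulr_gt0// oppr_gt0.
lra.
Qed.

Lemma closure_bounded Omega : bounded_set Omega -> bounded_set (closure Omega).
Proof.
move=> [M [Mr HM]]; exists M; split => // M' MM' x cx.
have e0 : 0 < (M' - M) / 2 by rewrite divr_gt0// subr_gt0.
have [y [Oy]] := cx _ (nbhsx_ballx x _ e0).
rewrite -ball_normE /= => xy.
have MM2 : M < (M' + M) / 2 by lra.
have := HM _ MM2 y Oy; have := ler_normD (x - y) y; rewrite subrK /=; lra.
Qed.

Section Mixed.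
Context (Omega D : set 'rV[R]_n) (nu : 'rV[R]_n -> 'rV[R]_n)
  (oO : open Omega) (Dbd : D `<=` boundary Omega)
  (Nopen : forall x, (boundary Omega `\` D) x ->
    \forall y \near x, boundary Omega y -> (boundary Omega `\` D) y)
  (normal : forall x, (boundary Omega `\` D) x ->
    exterior_unit_normal Omega x (nu x))
  (convex : forall z x, closure Omega z -> (boundary Omega `\` D) x ->
    z <> x -> 0 < dotv (normalize (x - z)) (nu x)).

Lemma domain_inward : inward Omega D nu.
Proof.
move=> x v Xx nDx Nx; have [Ox|bx] := off_Dirichlet Xx nDx; last first.
  exact: (normal_inward oO bx.1 (normal bx) (Nx bx)).
have /near_enorm[d d0 hd] : nbhs x Omega by apply: open_nbhs_nbhs.
have v0 : 0 < enorm v + 1 by rewrite ltr_wpDl.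
exists (d / (enorm v + 1)); first by rewrite divr_gt0.
move=> t /andP[t0]; rewrite ltr_pdivlMr// => td; apply: hd.
rewrite addrAC subrr add0r enormZ gtr0_norm//.
have : t * enorm v <= t * (enorm v + 1) by rewrite ler_wpM2l ?(ltW t0)// lerDl.
lra.
Qed.

Lemma domain_avoids x : closure Omega x -> ~ D x ->
  exists2 r : R, 0 < r & ball_avoids D x r.
Proof.
move=> Xx nDx.
suff [d d0 hd] : exists2 d : R, 0 < d & forall y, enorm (y - x) < d -> ~ D y.
  exists (d / 2); first by rewrite divr_gt0.
  move=> p Dp; rewrite ltNge; apply/negP => pd; apply: (hd p _ Dp); lra.
have [Ox|bx] := off_Dirichlet Xx nDx; last first.
  have /near_enorm[d d0 hd] := Nopen bx; exists d => // y yd Dy.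
  by have [_ []] := hd y yd (Dbd Dy).
have /near_enorm[d d0 hd] : nbhs x (interior Omega).
  by apply: nbhs_interior; apply: open_nbhs_nbhs.
by exists d => // y yd /Dbd[_]; apply; exact: hd.
Qed.

(** Let t be the last parameter up to which X is reached. At that point, which
    is not in D, the direction towards p is inward: trivially in Omega, and by
    convexity on GammaN. Hence the walk continues. *)
Lemma domain_visible z p (s : R) : closure Omega z -> closure Omega p ->
  z <> p -> 0 <= s -> s <= enorm (p - z) -> ball_avoids D z s ->
  closure Omega (toward z p s).
Proof.
move=> Xz Xp zp s0 sp farz.
have P0 : 0 < enorm (p - z) by apply: enorm_sub_gt0 => /esym.
pose S : set R := [set t | 0 <= t <= s /\ closure Omega (toward z p t)].
have S0 : S 0.
  by split; [rewrite lexx|rewrite /toward mul0r scale0r addr0].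
have Sub : has_ubound S by exists s => t [/andP[]].
have supS : has_sup S by split => //; exists 0.
pose t := sup S.
have tub r : S r -> r <= t by exact: (ub_le_sup Sub).
have t0 : 0 <= t by exact: tub.
have ts : t <= s by apply: ge_sup => [|r [/andP[]]//]; exists 0.
have towardB r : enorm (toward z p r - toward z p t) = `|r - t|.
  rewrite /toward opprD addrACA subrr add0r -scalerBl -mulrBl enormZ normrM.
  by rewrite normfV (ger0_norm (ltW P0)) divfK// gt_eqF.
have Xt : closure Omega (toward z p t).
  apply/closure_enorm => d d0; have d20 : 0 < d / 2 by rewrite divr_gt0.
  have [r [rs Xr] tr] := sup_adherent d20 supS.
  have [y Oy yr] := (closure_enorm _ _).1 Xr _ d20; exists y => //.
  have rt : r <= t by apply: tub; split.
  apply: le_lt_trans (edist_triangle (toward z p r) _ _) _.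
  rewrite towardB ler0_norm ?subr_le0//; move: tr; rewrite -/t; lra.
have [st|{}ts] := leP s t; first by rewrite (le_anti (_ : s <= t <= s)) ?st.
exfalso.
clearbody t => {supS towardB}.
have nDt : ~ D (toward z p t).
  by move=> /farz; rewrite toward_start// ltNge ltW.
have tP : t < enorm (p - z) by exact: lt_le_trans sp.
have pt : p <> toward z p t.
  move=> /(congr1 (fun y => enorm (p - y))).
  by rewrite toward_end// subrr enorm0 gtr0_norm ?subr_gt0//; lra.
have towards : (boundary Omega `\` D) (toward z p t) ->
    dotv (p - z) (nu (toward z p t)) < 0.
  move=> Nt; have := convex Xp Nt pt; rewrite dotvZl.
  have -> : toward z p t - p = (t / enorm (p - z) - 1) *: (p - z).
    by rewrite /toward scalerBl scale1r opprB [z + _]addrC -addrA.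
  rewrite dotvZl; apply: contraTT; rewrite -!leNgt => h.
  rewrite mulr_ge0_le0// ?invr_ge0// mulr_le0_ge0// subr_le0.
  by rewrite ler_pdivrMr// mul1r ltW.
have [d d0 hd] := domain_inward Xt nDt towards.
have st0 : 0 < s - t by rewrite subr_gt0.
have [e e0 [ed es _ _]] :=
  exists_below4 d0 (divr_gt0 st0 P0) ltr01 ltr01.
have := hd e; rewrite e0 ed => /(_ isT) Oe.
have Er : toward z p t + e *: (p - z) = toward z p (t + e * enorm (p - z)).
  rewrite /toward -addrA -scalerDl; congr (_ + _ *: _).
  by field; rewrite gt_eqF.
have : t + e * enorm (p - z) <= t.
  apply: tub; split.
    rewrite ltr_pdivlMr// in es; apply/andP; split; last by lra.
    by rewrite addr_ge0// mulr_ge0// ltW.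
  by rewrite -Er; exact: subset_closure.
by rewrite gerDl leNgt mulr_gt0.
Qed.

End Mixed.
End Domain.

(** * Existence and uniqueness *)

Theorem corollary3 (R : realType) (n : nat)
  (Omega GammaD GammaN : set 'rV[R]_n)
  (nu : 'rV[R]_n -> 'rV[R]_n) (F : 'rV[R]_n -> R)
  (Omega_domain : is_domain Omega)
  (Omega_bounded : bounded_set Omega)
  (GammaD_boundary : GammaD `<=` boundary Omega)
  (GammaD_nonempty : GammaD !=set0)
  (GammaN_def : GammaN = boundary Omega `\` GammaD)
  (GammaN_C1 : C1_boundary_portion Omega GammaN)
  (nu_normal : forall x, GammaN x -> exterior_unit_normal Omega x (nu x))
  (nu_continuous : {within GammaN, continuous nu})
  (F_lipschitz : lipschitz_on_set GammaD F)
  (GammaN_convex : forall z xs : 'rV[R]_n,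
     closure Omega z -> GammaN xs -> z <> xs ->
     0 < dotv (normalize (xs - z)) (nu xs)) :
  exists u : 'rV[R]_n -> R,
    mixed_problem_solution Omega GammaD nu F u /\
    (forall v : 'rV[R]_n -> R, mixed_problem_solution Omega GammaD nu F v ->
       forall x, closure Omega x -> v x = u x).
Proof.
have [[a Oa] oO cO] := Omega_domain.
have [p0 Dp0] := GammaD_nonempty.
have [_ portion] := GammaN_C1.
rewrite {}GammaN_def in portion nu_normal GammaN_convex.
have Nopen x : (boundary Omega `\` GammaD) x ->
    \forall y \near x, boundary Omega y -> (boundary Omega `\` GammaD) y.
  by move=> /portion[].
have inw : inward Omega GammaD nu by exact: domain_inward.
have dom : visible_domain (closure Omega) GammaD.
  split => //.
  - apply: bounded_closed_compact; first exact: closure_bounded.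
    exact: closed_closure.
  - exact: connected_closure.
  - by move=> p /GammaD_boundary[].
  - by move=> x; exact: domain_avoids.
  - by move=> z p s; exact: (domain_visible oO nu_normal GammaN_convex).
have other (x : 'rV[R]_n) : exists p, x <> p.
  have [->|/eqP xa] := eqVneq x a; last by exists a.
  exists p0 => ap0; have [_] := GammaD_boundary _ Dp0; apply.
  by rewrite -ap0; apply: open_nbhs_nbhs.
have [L L0 LF] : exists2 L : R, 0 <= L & forall p q, GammaD p -> GammaD q ->
    F q - F p <= L * enorm (q - p).
  have [L LF] := F_lipschitz; exists `|L| => // p q Dp Dq.
  apply: le_trans (ler_norm _) (le_trans (LF q p Dq Dp) _).
  by rewrite ler_wpM2r// ler_norm.
have [u [uu uNu cu cNu uF]] := perron dom L0 LF.
have usub v : mixed_problem_solution Omega GammaD nu F v ->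
    [/\ usc (closure Omega) v, no_touching (closure Omega) GammaD v,
        usc (closure Omega) (fun x => - v x) &
        no_touching (closure Omega) GammaD (fun x => - v x)].
  move=> [[/(supersolutionN _ _ _ _ _ other) super sub] _].
  have nt := subsolution_no_touching GammaN_convex sub.
  have ntN := subsolution_no_touching GammaN_convex super.
  by split => //; apply/usc_onE; [case: sub|case: super].
have solu : mixed_problem_solution Omega GammaD nu F u.
  split => //; split.
    apply/supersolutionN => //; apply: cone_comparison_subsolution => //.
    by move=> p /uF ->.
  apply: cone_comparison_subsolution => //.
  by move=> p /uF ->.
exists u; split => // v solv x Xx.
have [uv nv uNv nNv] := usub v solv; have [_ nu' _ nNu] := usub u solu.
have vF := solv.2.
have := @comparison R n _ _ F L u (fun x => - v x) dom L0 LF uu nu' _ uNv nNv _ x Xx.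
have := @comparison R n _ _ F L v (fun x => - u x) dom L0 LF uv nv _ uNu nNu _ x Xx.
move=> h1 h2.
have {}h1 : v x + - u x <= 0 by apply: h1 => p Dp; rewrite ?uF ?vF.
have {}h2 : u x + - v x <= 0 by apply: h2 => p Dp; rewrite ?uF ?vF.
by apply/eqP; rewrite eq_le; apply/andP; split; lra.
Qed.
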